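(* Let $d=d(n)$ be a sequence of positive integers (indexed by integers $n\ge 2$) with $d(n)\to\infty$ and $\log d(n)=o(\log n)$ as $n\to\infty$. Let $R_n=\left\lfloor\frac{n-1}{2}\right\rfloor$ and \[ A_n=R_n\mathbf 1_d+\bigl(\mathbb Z^d\cap\{x\in\mathbb R^d:\|x\|_2\le R_n\}\bigr), \] where $\mathbf 1_d=(1,\ldots,1)\in\mathbb R^d$. Then $A_n\subset\{0,1,\ldots,n-1\}^d$ and, as $n\to\infty$, \[ \log|A_n|=d\log n-\frac d2\log d+O(d), \] \[ \log E(A_n)=3\log|A_n|-d\log\frac{3\sqrt3}{4}+o(d). \] Consequently, \[ E(A_n)=|A_n|^{\,3-\frac{\log(3\sqrt3/4)+o(1)}{\log n}}=|A_n|^{\,3-(1+o(1))\log_n(3\sqrt3/4)}. \] In particular, one may take $d=\lfloor(\log n)^{1/2}\rfloor$.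
   Context: For a finite subset $A$ of an abelian group, the additive energy of $A$ is $E(A)=\#\{(a_1,a_2,a_3,a_4)\in A^4: a_1+a_2=a_3+a_4\}$. $\|\cdot\|_2$ is the Euclidean norm on $\mathbb R^d$, and $\log_n x=(\log x)/(\log n)$. All $o(\cdot)$ and $O(\cdot)$ terms refer to $n\to\infty$ with $d=d(n)$. *)

(* Defs.v *)
From HB Require Import structures.
From mathcomp Require Import all_boot all_order all_algebra finmap.
From mathcomp Require Import all_classical all_reals all_analysis.

Set Implicit Arguments.
Unset Strict Implicit.
Unset Printing Implicit Defensive.

Import Order.TTheory GRing.Theory Num.Theory.
Import numFieldNormedType.Exports.

Local Open Scope classical_set_scope.
Local Open Scope ring_scope.

Definition additive_energy (G : zmodType) (A : {fset G}) : nat :=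
  #|` [fset q in (A `*` A) `*` (A `*` A) |
        (q.1.1 + q.1.2 == q.2.1 + q.2.2)%R]|%fset.

(* The library norm on ['rV[R]_d] is the sup norm. *)
Definition euclidean_norm (R : realType) (d : nat) (x : 'rV[R]_d) : R :=
  Num.sqrt (\sum_(i < d) (x 0 i) ^+ 2).

Definition integer_lattice (R : realType) (d : nat) : set 'rV[R]_d :=
  [set x | x \is a mxOver Num.int].
Arguments integer_lattice : clear implicits.

Definition closed_ball_l2 (R : realType) (d : nat) (r : R) : set 'rV[R]_d :=
  [set x | euclidean_norm x <= r].
Arguments closed_ball_l2 : clear implicits.

Definition ball_radius (n : nat) : nat := ((n - 1) %/ 2)%N.

Definition shifted_lattice_ball (R : realType) (d n : nat) : set 'rV[R]_d :=
  [set const_mx (ball_radius n)%:R + x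
    | x in integer_lattice R d `&` closed_ball_l2 R d (ball_radius n)%:R].

Arguments shifted_lattice_ball : clear implicits.

Definition integer_box (R : realType) (d n : nat) : set 'rV[R]_d :=
  [set x | forall i, exists2 k : nat, (k < n)%N & x 0 i = k%:R].
Arguments integer_box : clear implicits.

Definition log_base (R : realType) (n : nat) (x : R) : R := ln x / ln n%:R.

(* [fset_set] sends an infinite set to the empty one; the inclusion in
   [integer_box], part of [energy_asymptotics], makes these sets finite. *)
Definition ball_card (R : realType) (d n : nat) : nat :=
  #|` fset_set (shifted_lattice_ball R d n)|%fset.

Definition ball_energy (R : realType) (d n : nat) : nat :=
  additive_energy (fset_set (shifted_lattice_ball R d n)).

Definition energy_asymptotics (R : realType) (d : nat -> nat) : Prop :=
  let cardA n : R := (ball_card R (d n) n)%:R in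
  let energyA n : R := (ball_energy R (d n) n)%:R in
  let c : R := 3 * Num.sqrt 3 / 4 in
  [/\ forall n, (2 <= n)%N ->
        shifted_lattice_ball R (d n) n `<=` integer_box R (d n) n,
      (fun n => ln (cardA n)) =
        (fun n => (d n)%:R * ln n%:R - (d n)%:R / 2 * ln (d n)%:R)
        +O_\oo (fun n => (d n)%:R : R),
      (fun n => ln (energyA n)) =
        (fun n => 3 * ln (cardA n) - (d n)%:R * ln c)
        +o_\oo (fun n => (d n)%:R : R),
      exists2 e : nat -> R, e =o_\oo (fun=> 1 : R) &
        \forall n \near \oo,
          energyA n = cardA n `^ (3 - (ln c + e n) / ln n%:R) &
      exists2 e : nat -> R, e =o_\oo (fun=> 1 : R) &
        \forall n \near \oo,
          energyA n = cardA n `^ (3 - (1 + e n) * log_base n c)].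

(* Main.v *)
(* Write [N(s)] for the number of integer vectors of Euclidean length at most
   [s], [h = sqrt d], and [r] for the radius, so that [r/h] tends to infinity.
   Volumes are replaced by the scaling inequality
   [N(s) <= ((s + h) / (r - h))^d N(r)], obtained by blowing up and shrinking
   the lattice; since [h = o(r)], it gives [N(a r) = a^d N(r) e^(o(d))].

   A quadruple [a1 + a2 = a3 + a4] is determined by [t = a1 - a3], [a1] and
   [a4], where [a1] and [a4] lie in the intersection of the ball with its
   translate by [t]. If [|t| = 2 a r], this intersection is contained in the
   ball of radius [r sqrt (1 - a^2)] around [t/2], and it contains at least
   half of a slightly smaller ball, because in high dimension most points of a
   ball are nearly orthogonal to [t] (Chebyshev's inequality). Hence, up to
   [e^(o(d))], the energy is [N(r)^3] times the [d]-th power of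
   [max_a 2 a (1 - a^2) = 4 / (3 sqrt 3)]. *)
Require Import Defs.
From mathcomp Require Import all_boot all_order perm all_algebra finmap.
From mathcomp Require Import all_classical all_reals all_analysis.
From mathcomp Require Import ring lra zify.

Import Order.TTheory GRing.Theory Num.Theory.
Import numFieldNormedType.Exports.

Local Open Scope classical_set_scope.
Local Open Scope ring_scope.

(** * Euclidean length and lattice balls *)

Definition dotp {R : pzRingType} {d : nat} (x y : 'rV[R]_d) : R :=
  \sum_(i < d) x 0 i * y 0 i.

Section EuclideanNorm.
Context {R : realType} {d : nat}.
Implicit Types x y : 'rV[R]_d.

Local Notation enorm := (@euclidean_norm R d).

Lemma enorm_ge0 x : 0 <= enorm x.
Proof. exact: sqrtr_ge0. Qed.

Lemma sqr_enorm x : enorm x ^+ 2 = \sum_(i < d) x 0 i ^+ 2.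
Proof. by rewrite sqr_sqrtr // sumr_ge0 // => i _; exact: sqr_ge0. Qed.

Lemma enorm_le_sqr x s : 0 <= s ->
  (enorm x <= s) = (\sum_(i < d) x 0 i ^+ 2 <= s ^+ 2).
Proof. by move=> s0; rewrite -sqr_enorm ler_sqr ?nnegrE ?enorm_ge0. Qed.

Lemma sqr_enormD x y :
  enorm (x + y) ^+ 2 = enorm x ^+ 2 + enorm y ^+ 2 + 2 * dotp x y.
Proof.
rewrite !sqr_enorm mulr_sumr -!big_split; apply: eq_bigr => i _ /=.
by rewrite mxE; ring.
Qed.

(** Cauchy-Schwarz from Lagrange's identity: the difference of the squares is half the sum of the
    squared minors [x 0 i * y 0 j - x 0 j * y 0 i]. *)
Lemma dotp_le x y : `|dotp x y| <= enorm x * enorm y.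
Proof.
rewrite -(@ler_sqr _ `|_|) ?nnegrE ?mulr_ge0 ?enorm_ge0 // real_normK ?num_real //.
rewrite exprMn !sqr_enorm expr2 !big_distrlr /= -subr_ge0.
set S := (X in _ - X); set T := (X in X - _).
have -> : T - S = 2^-1 * \sum_i \sum_j (x 0 i * y 0 j - x 0 j * y 0 i) ^+ 2.
  have TE : T = \sum_i \sum_j x 0 j ^+ 2 * y 0 i ^+ 2 by rewrite exchange_big.
  have -> : T - S = 2^-1 * (T + T - 2 * S) by lra.
  rewrite {2}TE -big_split mulr_sumr -sumrB; congr (_ * _).
  apply: eq_bigr => i _; rewrite -big_split mulr_sumr -sumrB.
  by apply: eq_bigr => j _ /=; ring.
by rewrite mulr_ge0 ?invr_ge0 // !sumr_ge0 // => i _; rewrite sumr_ge0 // => j _; exact: sqr_ge0.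
Qed.

Lemma enormD_le x y : enorm (x + y) <= enorm x + enorm y.
Proof.
rewrite -ler_sqr ?nnegrE ?addr_ge0 ?enorm_ge0 // sqr_enormD.
have := le_trans (ler_norm _) (dotp_le x y); lra.
Qed.

Lemma enormZ a x : enorm (a *: x) = `|a| * enorm x.
Proof.
rewrite -sqrtr_sqr /euclidean_norm -sqrtrM ?sqr_ge0 // mulr_sumr.
by congr Num.sqrt; apply: eq_bigr => i _; rewrite mxE exprMn.
Qed.

Lemma enormN x : enorm (- x) = enorm x.
Proof. by rewrite -scaleN1r enormZ normrN1 mul1r. Qed.

Lemma coord_le_enorm x i : `|x 0 i| <= enorm x.
Proof.
rewrite -ler_sqr ?nnegrE ?enorm_ge0 // sqr_enorm real_normK ?num_real //.
by rewrite (bigD1 i) //= lerDl sumr_ge0 // => j _; exact: sqr_ge0.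
Qed.

Lemma enorm_le_coord x a : 0 <= a -> (forall i, `|x 0 i| <= a) ->
  enorm x <= a * Num.sqrt d%:R.
Proof.
move=> a0 xa; rewrite enorm_le_sqr ?mulr_ge0 ?sqrtr_ge0 //.
rewrite exprMn sqr_sqrtr // -[in leRHS](card_ord d) mulr_natr -sumr_const.
by apply: ler_sum => i _; rewrite -real_normK ?num_real // ler_sqr ?nnegrE.
Qed.

(* Parallelogram law: the ball and its translate by [t] meet inside a ball
   around [t/2]. *)
Lemma enorm_midpoint x t r :
  enorm x <= r -> enorm (x - t) <= r ->
  enorm (x - 2^-1 *: t) ^+ 2 <= r ^+ 2 - (enorm t / 2) ^+ 2.
Proof.
move=> xr xtr; have r0 := le_trans (enorm_ge0 _) xr.
(* Both [x] and [x - t] are [x - t/2] plus or minus [t/2]; adding the two expansions cancels the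
   cross terms. *)
have := sqr_enormD (x - 2^-1 *: t) (2^-1 *: t).
have := sqr_enormD (x - 2^-1 *: t) (- (2^-1 *: t)).
rewrite -addrA -opprD -scalerDl -[2^-1 + _]mulr2n -[_ *+ 2]mulr_natl.
rewrite mulfV ?pnatr_eq0 // scale1r subrK.
rewrite enormN enormZ ger0_norm ?invr_ge0 // mulrC.
have -> : dotp (x - 2^-1 *: t) (- (2^-1 *: t)) = - dotp (x - 2^-1 *: t) (2^-1 *: t).
  by rewrite /dotp -sumrN; apply: eq_bigr => i _; rewrite !mxE mulrN.
have : enorm x ^+ 2 <= r ^+ 2 by rewrite ler_sqr ?nnegrE ?enorm_ge0.
have : enorm (x - t) ^+ 2 <= r ^+ 2 by rewrite ler_sqr ?nnegrE ?enorm_ge0.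
lra.
Qed.

End EuclideanNorm.

Section LatticeBall.
Context {R : realType} {d : nat}.
Implicit Types x y : 'rV[int]_d.

Definition real_vec x : 'rV[R]_d := map_mx intr x.

Definition lnorm x : R := euclidean_norm (real_vec x).

(** The diameter of the unit cube, hence a bound on any error that moves each coordinate by at most
    1. *)
Definition rootd : R := Num.sqrt d%:R.

Lemma lnorm_ge0 x : 0 <= lnorm x. Proof. exact: enorm_ge0. Qed.

Lemma real_vecD x y : real_vec (x + y) = real_vec x + real_vec y.
Proof. by rewrite /real_vec map_mxD. Qed.

Lemma real_vecB x y : real_vec (x - y) = real_vec x - real_vec y.
Proof. by rewrite /real_vec map_mxB. Qed.

Lemma real_vec_inj : injective real_vec.
Proof.
move=> x y /rowP xy; apply/rowP => i; have := xy i.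
by rewrite !mxE; exact: intr_inj.
Qed.

Lemma lnormD_le x y : lnorm (x + y) <= lnorm x + lnorm y.
Proof. by rewrite /lnorm real_vecD enormD_le. Qed.

Lemma lnorm_le_coord x (a : R) : 0 <= a -> (forall i, `|x 0 i|%:~R <= a) ->
  lnorm x <= a * rootd.
Proof.
by move=> a0 xa; apply: enorm_le_coord => // i; rewrite mxE -intr_norm.
Qed.

Lemma rootd_ge0 : 0 <= rootd. Proof. exact: sqrtr_ge0. Qed.

Lemma finite_lball (s : R) : finite_set [set x | lnorm x <= s].
Proof.
pose M := (Num.truncn s).+1.
pose f (g : {ffun 'I_d -> 'I_(M + M).+1}) : 'rV[int]_d :=
  \row_i ((g i)%:Z - M%:Z).
apply: (@sub_finite_set _ _ (f @` setT)); last exact: finite_image.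
move=> x /= xs.
have xM (i : 'I_d) : (`|x 0%R i| <= M)%N.
  have := le_lt_trans (le_trans (coord_le_enorm (real_vec x) i) xs) (truncnS_gt s).
  by rewrite mxE -intr_norm -abszE -pmulrn ltr_nat => /ltnW.
exists [ffun i => inord (absz (x 0 i + M%:Z))] => //.
apply/rowP => i; rewrite mxE ffunE inordK; have := xM i; lia.
Qed.

Definition lball (s : R) : {fset 'rV[int]_d} := fset_set [set x | lnorm x <= s].

Lemma in_lball s x : (x \in lball s) = (lnorm x <= s).
Proof. by rewrite in_fset_set; [exact: asboolb|exact: finite_lball]. Qed.

Lemma lball0 (s : R) : 0 <= s -> 0 \in lball s.
Proof.
move=> s0; rewrite in_lball /lnorm /real_vec map_mx0 enorm_le_sqr //.
by rewrite big1 ?sqr_ge0 // => i _; rewrite mxE expr0n.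
Qed.

Definition lcount (s : R) : nat := #|` lball s|%fset.

End LatticeBall.

Arguments rootd : clear implicits.
Arguments lball {R} d s.
Arguments lcount {R} d s.

(** * Scaling of lattice point counts *)

Lemma leq_card_fset_in {T U : choiceType} {A : {fset T}} {B : {fset U}}
    (f : T -> U) :
  (forall x, x \in A -> f x \in B) -> {in A &, injective f} ->
  (#|` A| <= #|` B|)%N.
Proof.
move=> fAB /card_in_imfsetP/eqP <-.
by apply: fsubset_leq_card; apply/fsubsetP => _ /imfsetP[x xA ->]; exact: fAB.
Qed.

Lemma big_fsetM {S : Type} {idx : S} {op : Monoid.com_law idx}
    {T U : choiceType} (A : {fset T}) (B : {fset U}) (F : T * U -> S) :
  \big[op/idx]_(p <- (A `*` B)%fset) F p =
  \big[op/idx]_(x <- A) \big[op/idx]_(y <- B) F (x, y).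
Proof. by rewrite big_imfset2 //= => -[x y] [x' y'] _ _ /= [-> ->]. Qed.

Lemma card_fsetM {T U : choiceType} (A : {fset T}) (B : {fset U}) :
  #|` (A `*` B)%fset| = (#|` A| * #|` B|)%N.
Proof. by rewrite -!sum1_size big_fsetM big_distrl; apply: eq_bigr => x _; rewrite [RHS]mul1n. Qed.

Section LatticeScaling.
Context {R : realType} {d : nat}.
Implicit Types (s t : R).

Local Notation h := (rootd R d).
Local Notation digits K := [fset x | x in {: {ffun 'I_d -> 'I_K}}]%fset.

Lemma card_digits K : #|` digits K| = (K ^ d)%N.
Proof. by rewrite card_imfset //= -cardE card_ffun !card_ord. Qed.

(** A point [x] and a digit vector [g] in [[0, K)^d] give [K x + g], of length at most
    [K |x| + K h]; Euclidean division recovers [x] and [g]. *)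
Lemma lcount_mul K s :
  (K ^ d * lcount d s <= lcount d (K%:R * (s + h)))%N.
Proof.
rewrite mulnC -card_digits -card_fsetM.
pose r (g : {ffun 'I_d -> 'I_K}) : 'rV[int]_d := \row_i (g i)%:Z.
apply: (@leq_card_fset_in _ _ _ _ (fun p => K%:Z *: p.1 + r p.2)).
  move=> [x g]; rewrite !inE /= => /andP[+ _]; rewrite !in_lball => xs.
  rewrite mulrDr (le_trans (lnormD_le _ _)) // lerD //.
    rewrite /lnorm /real_vec map_mxZ enormZ /= -pmulrn ger0_norm //.
    by rewrite ler_wpM2l.
  apply: lnorm_le_coord => // i; rewrite mxE -pmulrn ler_nat.
  exact: (ltnW (ltn_ord (g i))).
move=> [x g] [y g'] _ _ /= /rowP E.
have Exy i : x 0 i = y 0 i /\ g i = g' i :> nat.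
  have := E i; rewrite !mxE; have := ltn_ord (g i); have := ltn_ord (g' i).
  move: (x 0 i) (y 0 i) (nat_of_ord (g i)) (nat_of_ord (g' i)) => a b m n.
  move=> nK mK ab; have ab' : a = b.
    by case: (ltgtP a b) => // ?; exfalso; nia.
  by split => //; move: ab; rewrite ab'; lia.
congr pair; first by apply/rowP => i; have [] := Exy i.
by apply/ffunP => i; apply: val_inj; have [] := Exy i.
Qed.

(** Send a point to its coordinatewise quotient and remainder by [K]. As [K] times the quotient is
    the point minus the remainder, the quotient has length at most [t / K + h]. *)
Lemma lcount_div K t : (0 < K)%N ->
  (lcount d t <= K ^ d * lcount d (t / K%:R + h))%N.
Proof.
case: K => // K _; rewrite mulnC -card_digits -card_fsetM.
pose q (x : 'rV[int]_d) : 'rV[int]_d := \row_i (x 0%R i %/ K.+1)%Z.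
pose r (x : 'rV[int]_d) := [ffun i => inord `|(x 0%R i %% K.+1)%Z| : 'I_K.+1].
have rK (x : 'rV[int]_d) i : ((r x i)%:Z = x 0%R i %% K.+1)%Z.
  by rewrite ffunE inordK; lia.
apply: (@leq_card_fset_in _ _ _ _ (fun x => (q x, r x))).
  move=> x; rewrite in_lball => xt; rewrite !inE /= in_lball.
  apply/andP; split => //.
  rewrite -(@ler_pM2l _ K.+1%:R) ?ltr0n // mulrDr mulrCA mulfV ?pnatr_eq0 // mulr1.
  have -> : K.+1%:R * lnorm (q x) = lnorm (K.+1%:Z *: q x) :> R.
    by rewrite /lnorm /real_vec map_mxZ enormZ /= -pmulrn ger0_norm.
  have -> : K.+1%:Z *: q x = x + \row_i - (r x i)%:Z.
    by apply/rowP => i; rewrite !mxE rK {2}(divz_eq (x 0 i) K.+1) addrK mulrC.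
  rewrite (le_trans (lnormD_le _ _)) // lerD //.
  apply: lnorm_le_coord => // i; rewrite mxE normrN -pmulrn ler_nat.
  exact: (ltnW (ltn_ord (r x i))).
move=> x y _ _ /= [/rowP Eq /ffunP Er]; apply/rowP => i.
have := Eq i; rewrite !mxE => Eqi.
by rewrite (divz_eq (x 0 i) K.+1) (divz_eq (y 0 i) K.+1) Eqi -!rK Er.
Qed.

(* Discrete form of the comparison of the volumes of two balls: blow up by
   [K], shrink by [L ~ K (s + h) / (t - h)], and let [K] tend to infinity. *)
Lemma lcount_scale s t : 0 <= s -> h < t ->
  (lcount d s)%:R <= ((s + h) / (t - h)) ^+ d * (lcount d t)%:R.
Proof.
move=> s0 ht; have th0 : 0 < t - h by rewrite subr_gt0.
have h0 : 0 <= h := rootd_ge0.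
set a := (s + h) / (t - h).
have a0 : 0 <= a by exact: divr_ge0 (addr_ge0 s0 h0) (ltW th0).
have bound K : (lcount d s)%:R <= (a + K.+1%:R^-1) ^+ d * (lcount d t)%:R.
  have K0 : 0 < K.+1%:R :> R by rewrite ltr0n.
  (* [L / K.+1] lies between [a] and [a + 1 / K.+1]: the lower bound keeps the quotients within
     radius [t], the upper one gives a factor tending to [a ^+ d]. *)
  pose L := (Num.truncn (a * K.+1%:R)).+1.
  have L0 : 0 < L%:R :> R by rewrite ltr0n.
  have aL : a * K.+1%:R <= L%:R by rewrite ltW ?truncnS_gt.
  have La : L%:R <= (a + K.+1%:R^-1) * K.+1%:R.
    rewrite mulrDl mulVf ?gt_eqF // -[L%:R]natr1 lerD2r truncn_le //.
    by rewrite mulr_ge0 // ltW.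
  have Lt : K.+1%:R * (s + h) / L%:R + h <= t.
    rewrite -lerBrDr ler_pdivrMr //.
    have -> : s + h = a * (t - h) by rewrite divfK // gt_eqF.
    by rewrite mulrA mulrC ler_wpM2l ?(ltW th0) // mulrC.
  have := lcount_mul K.+1 s.
  have : (lcount d (K.+1%:R * (s + h)) <= L ^ d * lcount d t)%N.
    apply: (leq_trans (lcount_div L _ isT)); rewrite leq_mul2l.
    apply/orP; right; apply: fsubset_leq_card; apply/fsubsetP => x.
    by rewrite !in_lball => /le_trans; apply.
  move=> /[swap] /leq_trans /[apply].
  rewrite -(ler_nat R) !natrM !natrX => le1.
  rewrite -(@ler_pM2l _ (K.+1%:R ^+ d)) ?exprn_gt0 //.
  apply: (le_trans le1); rewrite mulrA ler_wpM2r // -exprMn lerXn2r ?nnegrE //.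
  - by rewrite mulr_ge0 // addr_ge0 // invr_ge0.
  - by rewrite mulrC.
have cvgB : (fun K => (a + K.+1%:R^-1) ^+ d * (lcount d t)%:R) @ \oo
    --> (a ^+ d * (lcount d t)%:R : R).
  apply: cvgMl; rewrite -[in X in _ --> X](addr0 a).
  apply: (@continuous_cvg _ _ _ _ _ _ (fun x : R => x ^+ d)).
    exact: exprn_continuous.
  by apply: cvgD; [exact: cvg_cst|exact: cvg_harmonic].
have := cvg_lim (@Rhausdorff R) cvgB => <-.
apply: limr_ge; first by apply/cvg_ex; eexists; exact: cvgB.
by near=> K; exact: bound.
Unshelve. all: by end_near. Qed.

End LatticeScaling.

(** * Two-sided exponential bounds for the lattice point count of a ball *)

Section LatticeBallSize.
Context {R : realType} {d : nat}.
Implicit Type t : R.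

Local Notation h := (rootd R d).

Lemma lcount_gt0 t : 0 <= t -> (0 < lcount d t)%N.
Proof.
move=> t0; rewrite cardfs_gt0; apply/fset0Pn; exists 0.
exact: lball0.
Qed.

(** Blow up the ball of radius 0 by the integer part [K] of [t / h]; since [t / h >= 1], [K] is at
    least half of [t / h]. *)
Lemma lcount_ge t : (0 < d)%N -> h <= t -> (t / (2 * h)) ^+ d <= (lcount d t)%:R.
Proof.
move=> d0 ht; have h0 : 0 < h by rewrite sqrtr_gt0 ltr0n.
have th : 1 <= t / h by rewrite ler_pdivlMr // mul1r.
pose K := Num.truncn (t / h).
have Kt : K%:R <= t / h by rewrite truncn_le // (le_trans ler01).
have tK : t / h < K%:R + 1 by rewrite natr1 truncnS_gt.
have K1 : 1 <= K%:R :> R by rewrite ler1n truncn_gt0.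
have := @lcount_mul R d K 0; rewrite add0r.
have sub : (lcount d (K%:R * h) <= lcount d t)%N.
  apply: fsubset_leq_card; apply/fsubsetP => x; rewrite !in_lball => /le_trans.
  by apply; rewrite -ler_pdivlMr.
move=> /leq_trans /(_ sub); rewrite -(ler_nat R) natrM natrX; apply: le_trans.
apply: (@le_trans _ _ (K%:R ^+ d)).
  have -> : t / (2 * h) = 2^-1 * (t / h) by rewrite invfM mulrCA.
  rewrite lerXn2r ?nnegrE //; lra.
by rewrite ler_peMr ?exprn_ge0 // ler1n lcount_gt0.
Qed.

(** Give [x] the weight 2 to the power minus the sum of the [|x_i|]. On this ball that sum is at
    most the sum of the [x_i^2], hence at most [4 d], so each weight is at least [2 ^- (4 d)]. The
    total weight factors over the coordinates and is at most [4 ^ d]; [64 = 2^4 * 4]. *)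
Lemma lcount_le_root : (lcount d (2 * h) <= 64 ^ d)%N.
Proof.
pose M := (4 * d)%N.
pose w (p : bool * 'I_M.+1) : R := 2^-1 ^+ p.2.
(* Sign and absolute value are separated, so that each coordinate contributes two partial geometric
   series, each of sum below 2. *)
pose enc (x : 'rV[int]_d) : {ffun 'I_d -> bool * 'I_M.+1} :=
  [ffun i => (x 0 i < 0, inord `|x 0%R i|%N)].
have sumx x : x \in lball d (2 * h) -> (\sum_i `|x 0%R i| <= M)%N.
  rewrite in_lball /lnorm enorm_le_sqr ?mulr_ge0 ?rootd_ge0 //.
  rewrite exprMn sqr_sqrtr // -natrX -natrM => xs.
  rewrite -(ler_nat R) natr_sum; apply: le_trans xs; apply: ler_sum => i _.
  rewrite mxE -rmorphXn /= pmulrn ler_int; nia.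
have encK x i : x \in lball d (2 * h) -> (enc x i).2 = `|x 0%R i|%N :> nat.
  move=> /sumx xM; rewrite ffunE inordK // ltnS (leq_trans _ xM) //.
  by rewrite (bigD1 i) //= leq_addr.
have enc_inj : {in lball d (2 * h) &, injective enc}.
  move=> x y xB yB E; apply/rowP => i.
  have Eabs : `|x 0%R i|%N = `|y 0%R i|%N by rewrite -encK // -[RHS]encK // E.
  have : (enc x i).1 = (enc y i).1 by rewrite E.
  rewrite !ffunE /=; move: (x 0 i) (y 0 i) Eabs => a b Eabs.
  by case: (ltP a 0); case: (ltP b 0) => // ? ? _; lia.
rewrite -(ler_nat R) natrX.
have -> : 64 = 2 ^+ 4 * 4 :> R by ring.
rewrite exprMn -exprM -/M.
rewrite -ler_pdivrMl ?exprn_gt0 //.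
apply: (@le_trans _ _ (\sum_(g : {ffun 'I_d -> bool * 'I_M.+1}) \prod_i w (g i))).
  apply: (@le_trans _ _ (\sum_(x <- lball d (2 * h)) \prod_i w (enc x i))).
    rewrite /lcount -sum1_size natr_sum mulr_sumr !big_seq; apply: ler_sum => x xB.
    rewrite mulr1 -exprVn prodrXr.
    under eq_bigr => i _ do rewrite encK //.
    by rewrite ler_wiXn2l ?invr_ge0 ?invf_le1 ?ler1n // sumx.
  rewrite -(big_map enc xpredT (fun g => \prod_i w (g i))) big_uniq /=; last first.
    by rewrite map_inj_in_uniq //; exact: fset_uniq.
  rewrite big_mkcond; apply: ler_sum => g _; case: ifP => // _.
  by apply: prodr_ge0 => i _; rewrite exprn_ge0 // invr_ge0.
rewrite -(bigA_distr_bigA (fun _ p => w p)) prodr_const card_ord.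
rewrite lerXn2r ?nnegrE ?sumr_ge0 //.
  by move=> p _; rewrite exprn_ge0 // invr_ge0.
rewrite -(pair_bigA _ (fun _ k => 2^-1 ^+ nat_of_ord k)) /= big_bool /=.
have geo n : \sum_(k < n) 2^-1 ^+ k <= 2 - 2^-1 ^+ n * 2 :> R.
  elim: n => [|n IHn]; first by rewrite big_ord0; lra.
  by rewrite big_ord_recr /= exprS; lra.
have := geo M.+1; have : 0 <= 2^-1 ^+ M.+1 :> R by rewrite exprn_ge0 // invr_ge0.
lra.
Qed.

(** Division by [K = floor (t / h) + 1] brings the ball within radius [2 h], and [K] is at most
    [2 (t / h)]; hence [128 = 2 * 64]. *)
Lemma lcount_le t : (0 < d)%N -> h <= t -> (lcount d t)%:R <= (128 * (t / h)) ^+ d.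
Proof.
move=> d0 ht; have h0 : 0 < h by rewrite sqrtr_gt0 ltr0n.
have th : 1 <= t / h by rewrite ler_pdivlMr // mul1r.
pose K := (Num.truncn (t / h)).+1.
have Kt : K%:R <= 1 + t / h.
  by rewrite -natr1 addrC lerD2l truncn_le // (le_trans ler01).
have tK : t / h <= K%:R by rewrite ltW // truncnS_gt.
have K0 : 0 < K%:R :> R by rewrite ltr0n.
have sub : (lcount d (t / K%:R + h) <= lcount d (2 * h))%N.
  apply: fsubset_leq_card; apply/fsubsetP => x; rewrite !in_lball => /le_trans.
  apply; rewrite mulr_natl mulr2n lerD2r ler_pdivrMr // mulrC.
  by rewrite -ler_pdivrMr.
have := leq_mul (leqnn (K ^ d)) (leq_trans sub lcount_le_root).
move=> /(leq_trans (lcount_div K t isT)); rewrite -expnMn.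
rewrite -(ler_nat R) natrX natrM => /le_trans; apply.
move: K (t / h) th Kt {tK K0 sub} => K q q1 Kq.
by rewrite lerXn2r ?nnegrE ?mulr_ge0 //; lra.
Qed.

End LatticeBallSize.

(** * Additive energy of a lattice ball *)

Lemma card_fset_cond {T : choiceType} (A : {fset T}) (P : pred T) :
  #|` [fset x in A | P x]%fset| = (\sum_(x <- A) P x)%N.
Proof.
by rewrite -sum1_size big_fset /= big_mkcond; apply: eq_bigr => x _; case: (P x).
Qed.

(** * Symmetries of the lattice ball and second moments of linear forms *)

Section SecondMoment.
Context {R : realType} {d : nat}.
Implicit Types (s : R) (t y : 'rV[int]_d).

(** Norm-preserving involutions permute the ball; sign changes and coordinate swaps are the two used
    below. *)
Lemma lball_reindex s (f : 'rV[int]_d -> 'rV[int]_d) (F : 'rV[int]_d -> R) :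
  involutive f -> (forall y, lnorm (f y) = lnorm y :> R) ->
  \sum_(y <- lball d s) F (f y) = \sum_(y <- lball d s) F y.
Proof.
move=> fK fn; rewrite -(big_map f xpredT F); apply: perm_big; apply: uniq_perm => //.
- by rewrite map_inj_uniq; [exact: fset_uniq|exact: inv_inj].
- exact: fset_uniq.
- move=> y; rewrite in_lball -fn -in_lball.
  apply/mapP/idP => [[x xs ->]|ys]; last by exists (f y).
  by rewrite fK.
Qed.

Local Notation moment s i j :=
  (\sum_(y <- lball d s) ((y 0 i)%:~R * (y 0 j)%:~R) : R).

Lemma moment_offdiag s i j : i != j -> moment s i j = 0.
Proof.
move=> ij; pose f (y : 'rV[int]_d) := \row_k (if k == i then - y 0 k else y 0 k).
have fK : involutive f.
  by move=> y; apply/rowP => k; rewrite !mxE; case: eqP => // _; rewrite opprK.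
have fn y : lnorm (f y) = lnorm y :> R.
  congr Num.sqrt; apply: eq_bigr => k _; rewrite !mxE.
  by case: eqP => // _; rewrite intrN sqrrN.
have := @lball_reindex s f (fun y => (y 0 i)%:~R * (y 0 j)%:~R) fK fn.
under eq_bigr => y _ do rewrite !mxE eqxx eq_sym (negPf ij) intrN mulNr.
by rewrite sumrN; lra.
Qed.

Lemma moment_diag s i j : moment s i i = moment s j j.
Proof.
pose f (y : 'rV[int]_d) := col_perm (tperm i j) y.
have fK : involutive f by move=> y; apply/rowP => k; rewrite !mxE tpermK.
have fn y : lnorm (f y) = lnorm y :> R.
  congr Num.sqrt; rewrite [RHS](reindex_inj (@perm_inj _ (tperm i j))).
  by apply: eq_bigr => k _; rewrite !mxE.
rewrite -(@lball_reindex s f (fun y => (y 0 i)%:~R * (y 0 i)%:~R) fK fn).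
by apply: eq_bigr => y _; rewrite mxE tpermL.
Qed.

(** By the sign and swap symmetries the second-moment matrix is scalar, and its trace is the sum of
    the [lnorm y ^+ 2]. *)
Lemma second_moment s t :
  d%:R * \sum_(y <- lball d s) dotp (real_vec y) (real_vec t) ^+ 2 =
  lnorm t ^+ 2 * \sum_(y <- lball d s) lnorm y ^+ 2 :> R.
Proof.
case: (posnP d) => [d0|d0].
  have -> : d%:R = 0 :> R by rewrite d0.
  rewrite /lnorm sqr_enorm mul0r big1 ?mul0r // => i.
  by have := leq_ltn_trans (leq0n i) (ltn_ord i); rewrite [in X in (_ < X)%N]d0.
pose i0 := Ordinal d0.
have -> : \sum_(y <- lball d s) lnorm y ^+ 2 = d%:R * moment s i0 i0.
  have -> (M : R) : d%:R * M = \sum_(i < d) M by rewrite sumr_const card_ord mulr_natl.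
  under eq_bigr => y _ do rewrite /lnorm sqr_enorm.
  rewrite exchange_big; apply: eq_bigr => i _ /=.
  by rewrite (moment_diag s i0 i); apply: eq_bigr => y _; rewrite mxE expr2.
rewrite mulrCA; congr (_ * _).
rewrite /lnorm sqr_enorm mulr_suml.
under eq_bigr => y _ do rewrite expr2 big_distrlr /=.
rewrite exchange_big; apply: eq_bigr => i _ /=.
rewrite exchange_big (bigD1 i) //= [X in _ + X]big1 ?addr0 => [|j ji].
  rewrite (moment_diag s i0 i) mulr_sumr; apply: eq_bigr => y _.
  by rewrite !mxE; ring.
rewrite (eq_bigr (fun y : 'rV[int]_d => ((t 0 i)%:~R * (t 0 j)%:~R) *
    ((y 0 i)%:~R * (y 0 j)%:~R))) => [|y _].
  by rewrite -mulr_sumr moment_offdiag ?mulr0 // eq_sym.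
by rewrite !mxE; ring.
Qed.

(** The average of the squared inner product gains a factor [d] over the Cauchy-Schwarz bound; this
    gain feeds Chebyshev's inequality. *)
Lemma second_moment_le s t : 0 <= s ->
  d%:R * \sum_(y <- lball d s) dotp (real_vec y) (real_vec t) ^+ 2 <=
  lnorm t ^+ 2 * (s ^+ 2 * (lcount d s)%:R) :> R.
Proof.
move=> s0; rewrite second_moment ler_wpM2l ?sqr_ge0 //.
rewrite /lcount -sum1_size natr_sum mulr_sumr !big_seq.
apply: ler_sum => y; rewrite in_lball => ys.
by rewrite mulr1 ler_sqr // nnegrE lnorm_ge0.
Qed.

End SecondMoment.

(** The midpoint [t/2] need not be a lattice point. Rounding it down makes an error with coordinates
    0 or 1/2. *)
Lemma lnorm_sub_half {R : realType} {d : nat} (y t : 'rV[int]_d) :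
  exists2 e : 'rV[R]_d, euclidean_norm e <= rootd R d &
    real_vec (y - \row_i (t 0%R i %/ 2)%Z) = real_vec y - 2^-1 *: real_vec t + e.
Proof.
exists (\row_i (2^-1 * (t 0%R i %% 2)%Z%:~R)).
  rewrite -[leRHS]mul1r; apply: enorm_le_coord => // i; rewrite mxE.
  have : 0 <= (t 0%R i %% 2)%Z by lia.
  have : (t 0%R i %% 2)%Z <= 1 by lia.
  rewrite -(ler_int R) -(ler0z R) => a1 a0.
  rewrite ger0_norm; lra.
apply/rowP => i; rewrite !mxE {2}(divz_eq (t 0 i) 2) rmorphB rmorphD rmorphM /=.
by field.
Qed.

Section Energy.
Context {R : realType} {d : nat}.
Implicit Types (r s : R) (a t y : 'rV[int]_d).

Local Notation h := (rootd R d).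
Local Notation half t := (\row_i (t 0%R i %/ 2)%Z).

(** The bound of [enorm_midpoint], recentred at the rounded midpoint at the cost of [h]. *)
Lemma lnorm_sub_half_le r s a t : 0 <= s -> s <= r ->
  lnorm a <= r -> lnorm (a - t) <= r -> s <= lnorm t / 2 ->
  lnorm (a - half t) <= Num.sqrt (r ^+ 2 - s ^+ 2) + h.
Proof.
move=> s0 sr ar atr st; have [e eh] := lnorm_sub_half a t (R := R).
rewrite {1}/lnorm => ->.
rewrite (le_trans (enormD_le _ _)) // lerD // enorm_le_sqr ?sqrtr_ge0 //.
have rs0 : s ^+ 2 <= r ^+ 2 by rewrite ler_sqr ?nnegrE // (le_trans s0).
rewrite sqr_sqrtr ?subr_ge0 // -sqr_enorm.
move: atr; rewrite {1}/lnorm real_vecB => /(enorm_midpoint _ _ _ ar) /le_trans; apply.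
by rewrite lerD2l lerN2 ler_sqr ?nnegrE // divr_ge0 // lnorm_ge0.
Qed.

(* Sort the quadruples [a1 + a2 = a3 + a4] by the length of [t = a1 - a3]:
   [a1] and [a4] lie in the intersection of the ball with its translate
   by [t]. *)
Lemma energy_le r m : 0 <= r ->
  (additive_energy (lball d r) <= \sum_(j < m.+1)
     lcount d (2 * r * (j.+1%:R / m.+1%:R)) *
     lcount d (Num.sqrt (r ^+ 2 - (r * (j%:R / m.+1%:R)) ^+ 2) + h) ^ 2)%N.
Proof.
move=> r0; rewrite /additive_energy.
set Q := (X in #|` X|).
(* Endpoints of [m.+1] shells of equal width covering the lengths from 0 to [2 r]. Adjacent shells
   share an endpoint, which is harmless for an upper bound. *)
pose lo (j : nat) : R := 2 * r * (j%:R / m.+1%:R).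
pose P j (q : ('rV[int]_d * 'rV[int]_d) * ('rV[int]_d * 'rV[int]_d)) :=
  lo j <= lnorm (q.1.1 - q.2.1) <= lo j.+1.
have exj q : q \in Q -> exists j : 'I_m.+1, P j q.
  rewrite !inE !in_lball => /andP[/andP[/andP[a1 _] /andP[a3 _]] _].
  pose t : R := lnorm (q.1.1 - q.2.1).
  have t2r : t <= lo m.+1.
    rewrite /lo divff ?pnatr_eq0 // mulr1 mulr_natl mulr2n.
    rewrite /t /lnorm real_vecB (le_trans (enormD_le _ _)) // lerD //.
    by rewrite enormN.
  have exk : exists k, (t <= lo k.+1) by exists m.
  case: (ex_minnP exk) => k tk kmin.
  have km : (k < m.+1)%N by exact: kmin.
  exists (Ordinal km); rewrite /P /= -/t tk andbT.
  case: k tk kmin km => [|k] tk kmin km; first by rewrite /lo mul0r mulr0 lnorm_ge0.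
  rewrite leNgt; apply/negP => /ltW /kmin; by rewrite ltnn.
apply: (@leq_trans (\sum_(j < m.+1) #|` [fset q in Q | P j q]%fset|)%N).
  under eq_bigr => j _ do rewrite card_fset_cond.
  rewrite exchange_big -sum1_size !big_seq; apply: leq_sum => q /exj[j Pj].
  by rewrite (bigD1 j) //= Pj.
apply: leq_sum => j _; rewrite /lcount expnS expn1 -!card_fsetM.
(* The points [a1 - t = a3] and [a4 - t = a2] lie in the ball, so both recentred points are short.
   Conversely [t], [a1] and [a4] determine [a3], then [a2]. *)
pose t (q : ('rV[int]_d * 'rV[int]_d) * ('rV[int]_d * 'rV[int]_d)) := q.1.1 - q.2.1.
apply: (@leq_card_fset_in _ _ _ _
  (fun q => (t q, (q.1.1 - half (t q), q.2.2 - half (t q))))).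
  move=> q; rewrite !inE /= !in_lball -/(t q).
  move=> /andP[/andP[/andP[/andP[a1 a2] /andP[a3 a4]] /eqP q12] /andP[tlo thi]].
  rewrite thi /=.
  have jr0 : 0 <= r * (j%:R / m.+1%:R) by rewrite mulr_ge0 ?divr_ge0.
  have jr : r * (j%:R / m.+1%:R) <= r.
    by rewrite ler_piMr // ler_pdivrMr ?ltr0n // mul1r ler_nat ltnW.
  have jt : r * (j%:R / m.+1%:R) <= lnorm (t q) / 2.
    by rewrite ler_pdivlMr // mulrC mulrA.
  apply/andP; split; apply: lnorm_sub_half_le => //.
    by rewrite /t opprB addrC subrK.
  by rewrite /t opprB addrA [_ + q.2.1]addrC -q12 [q.1.1 + _]addrC addrK.
move=> [[a1 a2] [a3 a4]] [[b1 b2] [b3 b4]]; rewrite !inE /t /=.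
move=> /andP[/andP[_ /eqP a12] _] /andP[/andP[_ /eqP b12] _] [tE].
rewrite tE => /addIr a1E /addIr a4E; move: tE a12 b12; rewrite a1E a4E.
move=> /addrI /oppr_inj -> a12; rewrite -a12 => /addrI ->.
by [].
Qed.

(* Conversely, if [y1] and [y2] are short and almost orthogonal to [t], then
   [t/2 + y1] and [t/2 + y2], rounded, lie in the ball and in its translate
   by [t]. *)
Lemma energy_ge_almost_orthogonal r s u k : 0 <= r -> 0 <= s ->
  (s + h) ^+ 2 + (u / 2) ^+ 2 + k + h * u <= r ^+ 2 ->
  (#|` [fset p in lball d u `*` (lball d s `*` lball d s) |
       (`|dotp (real_vec p.2.1) (real_vec p.1)| <= k)%R &&
       (`|dotp (real_vec p.2.2) (real_vec p.1)| <= k)%R]%fset| <=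
   additive_energy (lball d r))%N.
Proof.
move=> r0 s0 bnd.
(* Up to a rounding error [e] the two points are [y + t/2] and [y - t/2]. In the expansion of their
   squared lengths the cross term is at most [k], from [y], plus [h * u], from [e]. *)
have main y t : lnorm t <= u -> lnorm y <= s ->
    `|dotp (real_vec y) (real_vec t)| <= k ->
    (lnorm (y + half t) <= r) && (lnorm (y + half t - t) <= r).
  move=> tu ys yt; have [e eh] := lnorm_sub_half (- y) t (R := R).
  have -> : real_vec (- y - half t) = - real_vec (y + half t) :> 'rV[R]_d.
    by rewrite -opprD /real_vec map_mxN.
  have -> : real_vec (- y) = - real_vec y :> 'rV[R]_d by rewrite /real_vec map_mxN.
  move=> E.
  have E' : real_vec (y + half t) = (real_vec y - e) + 2^-1 *: real_vec t :> 'rV[R]_d.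
    by rewrite -[LHS]opprK E !opprD !opprK addrAC.
  have E'' : real_vec (y + half t - t) = (real_vec y - e) - 2^-1 *: real_vec t :> 'rV[R]_d.
    rewrite real_vecB E' -addrA; congr (_ + _).
    rewrite -{2}[real_vec t]scale1r -scalerBl -scaleNr; congr (_ *: _); lra.
  have ye : euclidean_norm (real_vec y - e) ^+ 2 <= (s + h) ^+ 2.
    rewrite ler_sqr ?nnegrE ?enorm_ge0 ?addr_ge0 ?rootd_ge0 //.
    by rewrite (le_trans (enormD_le _ _)) // enormN lerD.
  have u0 : 0 <= u := le_trans (lnorm_ge0 t) tu.
  have t2 : (lnorm t / 2) ^+ 2 <= (u / 2) ^+ 2.
    by rewrite ler_sqr ?nnegrE ?divr_ge0 ?lnorm_ge0 // ler_pM2r.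
  have et : `|dotp e (real_vec t)| <= h * u.
    by rewrite (le_trans (dotp_le _ _)) // ler_pM ?enorm_ge0.
  have dE : dotp (real_vec y - e) (2^-1 *: real_vec t) =
      2^-1 * (dotp (real_vec y) (real_vec t) - dotp e (real_vec t)).
    by rewrite /dotp -sumrB mulr_sumr; apply: eq_bigr => i _; rewrite !mxE; ring.
  have dNE : dotp (real_vec y - e) (- (2^-1 *: real_vec t)) =
      - (2^-1 * (dotp (real_vec y) (real_vec t) - dotp e (real_vec t))).
    by rewrite -dE /dotp -sumrN; apply: eq_bigr => i _; rewrite !mxE mulrN.
  have n2 : euclidean_norm (2^-1 *: real_vec t) ^+ 2 = (lnorm t / 2) ^+ 2 :> R.
    by rewrite enormZ ger0_norm ?invr_ge0 // mulrC.
  move: yt et; rewrite !ler_norml => /andP[yt1 yt2] /andP[et1 et2].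
  move: (real_vec y - e) E' E'' ye dE dNE => v E' E'' ye dE dNE.
  rewrite /lnorm E' E'' -!(@ler_sqr _ _ r) ?nnegrE ?enorm_ge0 // !sqr_enormD.
  rewrite enormN dE dNE n2; apply/andP; split; lra.
(* The quadruple is [a1 = y1 + half t], [a4 = y2 + half t], [a3 = a1 - t], [a2 = a4 - t]; it gives
   back [t] as [a1 - a3]. *)
apply: (@leq_card_fset_in _ _ _ _
  (fun p : 'rV[int]_d * ('rV[int]_d * 'rV[int]_d) =>
  ((p.2.1 + half p.1, p.2.2 + half p.1 - p.1),
   (p.2.1 + half p.1 - p.1, p.2.2 + half p.1)))).
  move=> p; rewrite !inE /= !in_lball.
  move=> /andP[/andP[tu /andP[y1s y2s]] /andP[d1 d2]].
  have /andP[-> ->] := main _ _ tu y1s d1.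
  have /andP[-> ->] := main _ _ tu y2s d2.
  by rewrite /= addrA addrAC eqxx.
move=> [t [y1 y2]] [t' [y1' y2']] _ _ /= [E1 E2 E3 E4].
have tt' : t = t' by move: E3; rewrite E1 => /addrI /oppr_inj.
by move: E1 E4; rewrite tt' => /addIr -> /addIr ->.
Qed.

(* Chebyshev's inequality: in high dimension most of a ball is almost
   orthogonal to a given direction. *)
Lemma energy_ge r s u k : 0 <= r -> 0 <= s -> 0 <= u -> 0 < k -> (0 < d)%N ->
  (s + h) ^+ 2 + (u / 2) ^+ 2 + k + h * u <= r ^+ 2 ->
  4 * (u * s) ^+ 2 <= d%:R * k ^+ 2 ->
  (lcount d u)%:R * (lcount d s)%:R ^+ 2 <=
    2 * (additive_energy (lball d r))%:R :> R.
Proof.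
move=> r0 s0 u0 k0 d0 bnd kd.
have k2 : 0 < k ^+ 2 by rewrite exprn_gt0.
have dR : 0 < d%:R :> R by rewrite ltr0n.
pose D y t : R := dotp (real_vec y) (real_vec t).
(* The weight [D y t ^+ 2 / k ^+ 2] is at least 1 when [y] is not almost orthogonal to [t]. By the
   factor 4 in the last hypothesis the weights for a given [t] add up to at most a quarter of the
   number of [y], so at most half of the pairs are lost. *)
pose S := \sum_(t <- lball d u) \sum_(y <- lball d s) D y t ^+ 2 / k ^+ 2.
have SE : S <= 4^-1 * ((lcount d u)%:R * (lcount d s)%:R).
  rewrite {1}/lcount -sum1_size natr_sum mulr_suml mulr_sumr /S !big_seq.
  apply: ler_sum => t; rewrite in_lball => tu.
  rewrite -mulr_suml ler_pdivrMr // -(ler_pM2l dR).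
  apply: (le_trans (second_moment_le s t s0)).
  have tu2 : lnorm t ^+ 2 <= u ^+ 2 by rewrite ler_sqr ?nnegrE ?lnorm_ge0.
  have -> : d%:R * (4^-1 * (1 * (lcount d s)%:R) * k ^+ 2) =
    4^-1 * (d%:R * k ^+ 2) * (lcount d s)%:R by ring.
  rewrite mulrA ler_wpM2r // (@le_trans _ _ (u ^+ 2 * s ^+ 2)) //.
    by rewrite ler_wpM2r ?sqr_ge0.
  by rewrite -exprMn; lra.
have := energy_ge_almost_orthogonal _ _ _ _ r0 s0 bnd.
rewrite -(ler_nat R) card_fset_cond natr_sum big_fsetM /= => le1.
suff : (lcount d u)%:R * (lcount d s)%:R ^+ 2 - 2 * (lcount d s)%:R * S <=
    (additive_energy (lball d r))%:R.
  move: SE; set N := (lcount d s)%:R; set M := (lcount d u)%:R => SE.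
  have N0 : 0 <= N by rewrite /N.
  have : N * S <= N * (4^-1 * (M * N)) by rewrite ler_wpM2l.
  rewrite expr2; lra.
apply: le_trans le1.
have sumc (A : {fset 'rV[int]_d}) (c : R) : \sum_(y <- A) c = (#|` A|)%:R * c.
  by rewrite -sum1_size natr_sum mulr_suml; apply: eq_bigr => y _; rewrite mul1r.
(* Union bound: the indicator that [y1] and [y2] are both almost orthogonal to [t] is at least 1
   minus their two weights. *)
apply: (@le_trans _ _ (\sum_(t <- lball d u) \sum_(p <- (lball d s `*` lball d s)%fset)
   (1 - D p.1 t ^+ 2 / k ^+ 2 - D p.2 t ^+ 2 / k ^+ 2))).
  rewrite le_eqVlt; apply/orP; left; apply/eqP.
  transitivity (\sum_(t <- lball d u) ((lcount d s)%:R ^+ 2 -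
      2 * (lcount d s)%:R * \sum_(y <- lball d s) D y t ^+ 2 / k ^+ 2)).
    by rewrite sumrB sumc -mulr_sumr.
  apply: eq_bigr => t _; rewrite big_fsetM /=.
  under [RHS]eq_bigr => y1 _ do rewrite sumrB sumc.
  by rewrite sumrB -mulr_sumr sumrB !sumc /lcount; ring.
apply: ler_sum => t _; apply: ler_sum => -[y1 y2] _ /=.
have bad y : ~~ (`|D y t| <= k) -> 1 <= D y t ^+ 2 / k ^+ 2.
  rewrite -ltNge ler_pdivlMr // mul1r => /ltW kD.
  by rewrite -[D y t ^+ 2]real_normK ?num_real // ler_sqr ?nnegrE // ltW.
have D0 y : 0 <= D y t ^+ 2 / k ^+ 2 by rewrite divr_ge0 ?sqr_ge0.
have := D0 y1; have := D0 y2; rewrite -!/(D _ _).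
case: (boolP (`|D y1 t| <= k)) => [_|/bad]; last by rewrite /=; lra.
case: (boolP (`|D y2 t| <= k)) => [_|/bad]; by rewrite /=; lra.
Qed.
End Energy.

(** * From the shifted real ball to integer vectors *)

Lemma additive_energyE (G : zmodType) (A : {fset G}) :
  additive_energy A = (\sum_(a1 <- A) \sum_(a2 <- A) \sum_(a3 <- A)
    \sum_(a4 <- A) (a1 + a2 == a3 + a4)%R)%N.
Proof.
rewrite /additive_energy card_fset_cond !big_fsetM; apply: eq_bigr => a1 _.
by apply: eq_bigr => a2 _; rewrite big_fsetM.
Qed.

(** Energy only sees additive quadruples, so a Freiman isomorphism of order 2 preserves it. This
    covers an embedding followed by a translation, which is not additive. *)
Lemma additive_energy_imfset (G H : zmodType) (f : G -> H) (A : {fset G}) :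
  injective f ->
  (forall a b c e, (f a + f b == f c + f e) = (a + b == c + e)) ->
  additive_energy (f @` A)%fset = additive_energy A.
Proof.
move=> f_inj fD; rewrite !additive_energyE.
have sumf (F : H -> nat) : (\sum_(a <- (f @` A)%fset) F a = \sum_(a <- A) F (f a))%N.
  by rewrite big_imfset //= => a b _ _; exact: f_inj.
rewrite sumf; apply: eq_bigr => a1 _; rewrite sumf; apply: eq_bigr => a2 _.
rewrite sumf; apply: eq_bigr => a3 _; rewrite sumf; apply: eq_bigr => a4 _.
by rewrite fD.
Qed.

Section ShiftedBall.
Context {R : realType}.
Variables (d n : nat).

Local Notation r := ((ball_radius n)%:R : R).
Let shift (x : 'rV[int]_d) : 'rV[R]_d := const_mx r + real_vec x.

Let shift_inj : injective shift.
Proof. by move=> x y /addrI /real_vec_inj. Qed.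

Lemma shifted_lattice_ballE :
  shifted_lattice_ball R d n = shift @` [set x | lnorm x <= r].
Proof.
apply/seteqP; split => y [x /=].
  move=> [/mxOverP xint xr] <-.
  have xE : x = real_vec (map_mx Num.floor x).
    by apply/rowP => i; rewrite !mxE floorK.
  by exists (map_mx Num.floor x); rewrite /shift -?xE // /lnorm -xE.
move=> xr <-; exists (real_vec x) => //; split => //.
by apply/mxOverP => i j; rewrite mxE intr_int.
Qed.

Lemma fset_shifted_lattice_ball :
  fset_set (shifted_lattice_ball R d n) = (shift @` lball d r)%fset.
Proof. by rewrite shifted_lattice_ballE fset_set_image //; exact: finite_lball. Qed.

Lemma ball_cardE : ball_card R d n = lcount d r.
Proof.
rewrite /ball_card fset_shifted_lattice_ball.
by apply/eqP/card_in_imfsetP => x y _ _; exact: shift_inj.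
Qed.

Lemma ball_energyE : ball_energy R d n = additive_energy (lball d r).
Proof.
rewrite /ball_energy fset_shifted_lattice_ball additive_energy_imfset //.
have shiftD a b : shift a + shift b = const_mx r + const_mx r + real_vec (a + b).
  by rewrite addrACA real_vecD.
by move=> a b c e; rewrite !shiftD (inj_eq (addrI _)) (inj_eq real_vec_inj).
Qed.

(** Coordinates in [[-r, r]] are shifted into [[0, 2 r]], and [2 r <= n - 1] because [r] is rounded
    down. *)
Lemma shifted_lattice_ball_box : (2 <= n)%N ->
  shifted_lattice_ball R d n `<=` integer_box R d n.
Proof.
move=> n2; rewrite shifted_lattice_ballE => _ [x /= xr <-] i.
have := le_trans (coord_le_enorm (real_vec x) i) xr.
rewrite mxE -intr_norm [r]pmulrn ler_int => xi.
exists (absz ((ball_radius n)%:Z + x 0 i)); first by rewrite /ball_radius in xi *; lia.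
rewrite !mxE natr_absz ger0_norm ?intrD -?pmulrn //.
by rewrite /ball_radius in xi *; lia.
Qed.

End ShiftedBall.

(** * Asymptotics *)

Section EnergyEstimate.
Context {R : realType}.

Local Notation c := (3 * Num.sqrt 3 / 4 : R).
(** The maximiser [1 / sqrt 3] of [2 a (1 - a^2)] over [a >= 0]. *)
Local Notation g := (Num.sqrt 3 / 3 : R).

Lemma sqrt3_bounds : [/\ Num.sqrt 3 ^+ 2 = 3 :> R, 3/2 < Num.sqrt 3 :> R & Num.sqrt 3 < 2 :> R].
Proof.
have s2 : Num.sqrt 3 ^+ 2 = 3 :> R by rewrite sqr_sqrtr.
have s0 : 0 <= Num.sqrt 3 :> R by exact: sqrtr_ge0.
split => //.
  by rewrite -ltr_sqr ?nnegrE //; lra.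
by rewrite -ltr_sqr ?nnegrE //; lra.
Qed.

Lemma energy_const_inv : c^-1 = 4 / 3 * g.
Proof.
have [s2 s1 _] := sqrt3_bounds.
have s0 : Num.sqrt 3 != 0 :> R by rewrite gt_eqF //; lra.
have -> : 4 / 3 * g = 4 / (9 * Num.sqrt 3) * Num.sqrt 3 ^+ 2 :> R by field.
by rewrite s2; field.
Qed.

Lemma energy_const_bounds : 1 < c < 2.
Proof. have [_ s1 s2] := sqrt3_bounds; apply/andP; split; lra. Qed.

(* The exponential rate of the energy is [max_a 2a(1 - a^2) = 4 / (3 sqrt 3)],
   where [a = |t| / 2r]. *)
Lemma rate_le (a : R) : 0 <= a -> 2 * a * (1 - a ^+ 2) <= c^-1.
Proof.
move=> a0; rewrite energy_const_inv; have [s2 s1 _] := sqrt3_bounds.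
(* Twice this cubic is [c^-1 - 2 a (1 - a^2)]; the double root is the maximiser. *)
have : 0 <= (a - g) ^+ 2 * (a + 2 * g) by rewrite mulr_ge0 ?sqr_ge0 //; lra.
have g2 : g ^+ 2 = 1 / 3 by rewrite exprMn s2; lra.
have -> : (a - g) ^+ 2 * (a + 2 * g) = a ^+ 3 - 3 * g ^+ 2 * a + 2 * g ^+ 2 * g by ring.
rewrite g2; have -> : 2 * a * (1 - a ^+ 2) = 2 * a - 2 * a ^+ 3 by ring.
lra.
Qed.

(** Stability of the rate under relative errors of size [th]. Around the main term [2 a b^2] the
    errors contribute [8 + 8 + 27 = 43]. *)
Lemma rate_perturb_le (a b th : R) : 0 <= a <= 1 -> 0 <= b <= 1 ->
  b ^+ 2 = 1 - a ^+ 2 -> 0 <= th <= 1 ->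
  (2 * a + 3 * th) * (b + 2 * th) ^+ 2 <= c^-1 + 43 * th.
Proof.
move=> /andP[a0 a1] /andP[b0 b1] b2 /andP[t0 t1].
have := rate_le a a0; rewrite -b2.
have th2 : 0 <= th ^+ 2 <= th by rewrite sqr_ge0 expr2 ler_piMr.
have abt : 0 <= a * b * th <= th.
  by rewrite !mulr_ge0 //= -[leRHS]mul1r ler_wpM2r // mulr_ile1.
have att : 0 <= a * th ^+ 2 <= th.
  move: th2 => /andP[th20 th21].
  by rewrite mulr_ge0 //= (le_trans _ th21) // ler_piMl.
have bt : 0 <= th * (b + 2 * th) ^+ 2 <= 9 * th.
  rewrite mulr_ge0 ?sqr_ge0 //= mulrC ler_wpM2r //.
  have -> : 9 = 3 ^+ 2 :> R by ring.
  by rewrite ler_sqr ?nnegrE ?addr_ge0 ?mulr_ge0 //; lra.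
have -> : (2 * a + 3 * th) * (b + 2 * th) ^+ 2 =
  2 * a * b ^+ 2 + 8 * (a * b * th) + 8 * (a * th ^+ 2) +
  3 * (th * (b + 2 * th) ^+ 2) by ring.
lra.
Qed.

Variable d : nat.
Local Notation h := (rootd R d).

Lemma exprMM2 (x y z : R) :
  x ^+ d * z * (y ^+ d * z) ^+ 2 = (x * y ^+ 2) ^+ d * z ^+ 3.
Proof.
rewrite (exprMn d x (y ^+ 2)) exprAC.
by move: (x ^+ d) (y ^+ d) => X Y; ring.
Qed.

Lemma lcount_scale_le (r s q : R) : 0 <= s -> h < r -> s + h <= q * (r - h) ->
  (lcount d s)%:R <= q ^+ d * (lcount d r)%:R.
Proof.
move=> s0 hr sq; have rh : 0 < r - h by rewrite subr_gt0.
apply: (le_trans (lcount_scale s r s0 hr)).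
have h0 : 0 <= h := rootd_ge0.
have q1 : (s + h) / (r - h) <= q by rewrite ler_pdivrMr.
rewrite ler_wpM2r // lerXn2r ?nnegrE //.
  exact: divr_ge0 (addr_ge0 s0 h0) (ltW rh).
by apply: le_trans q1; exact: divr_ge0 (addr_ge0 s0 h0) (ltW rh).
Qed.

(** Here [lcount_scale] bounds the count at [r] by that at [s] with ratio [(r + h) / (s - h)], and
    [q] times this ratio is at most 1. *)
Lemma lcount_scale_ge (r s q : R) : 0 <= r -> h < s -> 0 <= q ->
  q * (r + h) <= s - h -> q ^+ d * (lcount d r)%:R <= (lcount d s)%:R.
Proof.
move=> r0 hs q0 qs; have sh : 0 < s - h by rewrite subr_gt0.
have h0 : 0 <= h := rootd_ge0.
apply: (le_trans (ler_wpM2l (exprn_ge0 d q0) (lcount_scale r s r0 hs))).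
rewrite mulrA ler_piMl // -exprMn exprn_ile1 //.
  exact: mulr_ge0 q0 (divr_ge0 (addr_ge0 r0 h0) (ltW sh)).
by rewrite mulrA ler_pdivrMr // mul1r.
Qed.

(** [th] dominates both [h / r] and [1 / m.+1]. Every shell is bounded by the maximal rate, whence
    the factor [m.+1]. *)
Lemma energy_upper (r th : R) (m : nat) : 0 < r -> 0 < th -> th <= 2^-1 ->
  h <= th * r -> m.+1%:R^-1 <= th ->
  (additive_energy (lball d r))%:R <=
  m.+1%:R * (((c^-1 + 43 * th) / (1 - th) ^+ 3) ^+ d * (lcount d r)%:R ^+ 3) :> R.
Proof.
move=> r0 th0 th1 hr mth; have h0 : 0 <= h := rootd_ge0.
have thr : th * r < r by rewrite gtr_pMl //; lra.
have hr1 : h < r by exact: le_lt_trans thr.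
have rh : (1 - th) * r <= r - h by rewrite mulrBl mul1r lerD2l lerN2.
have t1 : 0 < 1 - th by lra.
have := energy_le r m (ltW r0) (d := d); rewrite -(ler_nat R) natr_sum => /le_trans; apply.
have -> (M : R) : m.+1%:R * M = \sum_(j < m.+1) M.
  by rewrite sumr_const card_ord mulr_natl.
apply: ler_sum => j _.
set a := j%:R / m.+1%:R; pose b := Num.sqrt (1 - a ^+ 2).
have a0 : 0 <= a by rewrite divr_ge0.
have a1 : a <= 1 by rewrite ler_pdivrMr ?ltr0n // mul1r ler_nat ltnW.
have a2 : 0 <= 1 - a ^+ 2 by rewrite subr_ge0 expr_le1.
have b2 : b ^+ 2 = 1 - a ^+ 2 by rewrite sqr_sqrtr.
have b0 : 0 <= b := sqrtr_ge0 _.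
have b1 : b <= 1 by rewrite -(@expr_le1 _ 2) // b2 gerBl sqr_ge0.
have -> : Num.sqrt (r ^+ 2 - (r * a) ^+ 2) = r * b.
  rewrite exprMn -[X in X - _]mulr1 -mulrBr sqrtrM ?sqr_ge0 // sqrtr_sqr.
  by rewrite gtr0_norm.
(* The shell width adds [2 th] to [2 a], the scaling inequality a further [th]. *)
have le1 : (lcount d (2 * r * (j.+1%:R / m.+1%:R)))%:R <=
    ((2 * a + 3 * th) / (1 - th)) ^+ d * (lcount d r)%:R :> R.
  have aS : j.+1%:R / m.+1%:R <= a + th by rewrite -natr1 mulrDl mul1r lerD2l.
  apply: lcount_scale_le => //.
    by rewrite mulr_ge0 ?divr_ge0 // mulr_ge0 // ltW.
  apply: (@le_trans _ _ ((2 * a + 3 * th) / (1 - th) * ((1 - th) * r))).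
    rewrite [leRHS]mulrA divfK ?gt_eqF //.
    have : r * (j.+1%:R / m.+1%:R) <= r * (a + th) by rewrite ler_wpM2l // ltW.
    by move: (j.+1%:R / m.+1%:R) => x; lra.
  by apply: ler_wpM2l => //; apply: divr_ge0; lra.
(* One [h] comes from rounding the midpoint, another from the scaling inequality. *)
have le2 : (lcount d (r * b + h))%:R <=
    ((b + 2 * th) / (1 - th)) ^+ d * (lcount d r)%:R :> R.
  apply: lcount_scale_le => //.
    by rewrite addr_ge0 // mulr_ge0 // ltW.
  apply: (@le_trans _ _ ((b + 2 * th) / (1 - th) * ((1 - th) * r))).
    by rewrite [leRHS]mulrA divfK ?gt_eqF //; lra.
  by apply: ler_wpM2l => //; apply: divr_ge0; lra.
have base : (2 * a + 3 * th) / (1 - th) * ((b + 2 * th) / (1 - th)) ^+ 2 <=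
    (c^-1 + 43 * th) / (1 - th) ^+ 3.
  have -> : (2 * a + 3 * th) / (1 - th) * ((b + 2 * th) / (1 - th)) ^+ 2 =
      (2 * a + 3 * th) * (b + 2 * th) ^+ 2 / (1 - th) ^+ 3.
    by field; rewrite gt_eqF.
  rewrite ler_wpM2r ?invr_ge0 ?exprn_ge0 ?(ltW t1) //.
  by apply: rate_perturb_le => //; rewrite ?a0 ?b0 // ltW //=; lra.
rewrite natrM natrX.
apply: (@le_trans _ _ ((((2 * a + 3 * th) / (1 - th)) ^+ d * (lcount d r)%:R) *
  (((b + 2 * th) / (1 - th)) ^+ d * (lcount d r)%:R) ^+ 2)).
  by rewrite ler_pM ?exprn_ge0 // lerXn2r ?nnegrE // (le_trans _ le2).
rewrite exprMM2 ler_wpM2r ?exprn_ge0 //.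
have p1 : 0 <= (2 * a + 3 * th) / (1 - th) * ((b + 2 * th) / (1 - th)) ^+ 2.
  by rewrite mulr_ge0 ?sqr_ge0 // divr_ge0 ?(ltW t1) //; lra.
by rewrite lerXn2r ?nnegrE // (le_trans p1).
Qed.

(** One choice of radii suffices: [|t|] up to the optimal [2 g r], and [y] up to [p r] with
    [p = sqrt (1 - g^2)], shrunk by [1 - del] to leave room for rounding and for
    [k = del / 3 * r^2]. *)
Lemma energy_lower (r del : R) : 0 < r -> 0 < del -> del <= 4^-1 -> (0 < d)%N ->
  h <= del / 15 * r -> 32 <= d%:R * del ^+ 2 ->
  (c^-1 * ((1 - del) * (1 - 2 * del) ^+ 2 / (1 + del) ^+ 3)) ^+ d *
    (lcount d r)%:R ^+ 3 <= 2 * (additive_energy (lball d r))%:R :> R.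
Proof.
move=> r0 e0 e1 d0 hr de; have h0 : 0 <= h := rootd_ge0.
have [s2 s1 s1'] := sqrt3_bounds.
have g2 : g ^+ 2 = 1 / 3 by rewrite exprMn s2; lra.
pose p : R := Num.sqrt (2 / 3).
have p2 : p ^+ 2 = 2 / 3 by rewrite sqr_sqrtr //; lra.
have p0 : 0 <= p := sqrtr_ge0 _.
have p8 : 4/5 <= p by rewrite -ler_sqr ?nnegrE // p2; lra.
have p1 : p <= 1 by rewrite -ler_sqr ?nnegrE // p2; lra.
have q1 : 0 <= (1 - del) / (1 + del) by apply: divr_ge0; lra.
have q2 : 0 <= (1 - 2 * del) / (1 + del) by apply: divr_ge0; lra.
have b1 : 0 <= 2 * g * ((1 - del) / (1 + del)) by apply: mulr_ge0 => //; lra.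
have b2 : 0 <= p * ((1 - 2 * del) / (1 + del)) by exact: mulr_ge0.
have er : 0 < del * r by rewrite mulr_gt0.
have er1 : del * r <= 4^-1 * r by rewrite ler_wpM2r // ltW.
pose u := 2 * g * r; pose s := p * (1 - del) * r.
have u0 : 0 <= u by rewrite /u mulr_ge0 ?(ltW r0) //; lra.
have s0 : 0 <= s by rewrite /s !mulr_ge0 ?(ltW r0) //; lra.
have le1 : (2 * g * ((1 - del) / (1 + del))) ^+ d * (lcount d r)%:R <= (lcount d u)%:R :> R.
  apply: lcount_scale_ge; rewrite ?(ltW r0) //.
  - rewrite /u; have : 1 * r <= 2 * g * r by rewrite ler_wpM2r ?(ltW r0) //; lra.
    lra.
  - apply: (@le_trans _ _ (2 * g * ((1 - del) / (1 + del)) * ((1 + del) * r))).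
      by apply: ler_wpM2l => //; lra.
    have -> : 2 * g * ((1 - del) / (1 + del)) * ((1 + del) * r) = u - 2 * g * (del * r).
      by rewrite /u; field; rewrite gt_eqF //; lra.
    rewrite lerD2l lerN2 (@le_trans _ _ (1 * (del * r))) //; first lra.
    by rewrite ler_wpM2r ?(ltW er) //; lra.
have le2 : (p * ((1 - 2 * del) / (1 + del))) ^+ d * (lcount d r)%:R <= (lcount d s)%:R :> R.
  apply: lcount_scale_ge; rewrite ?(ltW r0) //.
  - rewrite /s; have : 4/5 * (1 - del) * r <= p * (1 - del) * r.
      by rewrite !ler_wpM2r ?(ltW r0) //; lra.
    lra.
  - apply: (@le_trans _ _ (p * ((1 - 2 * del) / (1 + del)) * ((1 + del) * r))).
      by apply: ler_wpM2l => //; lra.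
    have -> : p * ((1 - 2 * del) / (1 + del)) * ((1 + del) * r) = s - p * (del * r).
      by rewrite /s; field; rewrite gt_eqF //; lra.
    rewrite lerD2l lerN2 (@le_trans _ _ (4/5 * (del * r))) //; first lra.
    by rewrite ler_wpM2r ?(ltW er) //; lra.
(* In units of [r^2], shrinking [s] frees at least [2 del / 3]. Of this [k] takes [del / 3], and
   [2 h s + h^2 + h u] at most [5 del / 15]: hence the 15. *)
have bnd : (s + h) ^+ 2 + (u / 2) ^+ 2 + del / 3 * r ^+ 2 + h * u <= r ^+ 2.
  have sr : s <= r.
    by rewrite /s ler_piMl ?(ltW r0) // mulr_ile1 //; lra.
  have u2 : u <= 2 * r by rewrite /u ler_wpM2r ?(ltW r0) //; lra.
  have hs : h * s <= del / 15 * r * r by rewrite ler_pM.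
  have hu : h * u <= del / 15 * r * (2 * r) by rewrite ler_pM.
  have hh : h * h <= del / 15 * r * r by rewrite ler_pM //; lra.
  have ss : s ^+ 2 <= 2 / 3 * (1 - del) * r ^+ 2.
    rewrite /s !exprMn p2 ler_wpM2r ?sqr_ge0 //.
    apply: ler_wpM2l; first lra.
    by rewrite expr2 ler_piMr //; lra.
  have uu : (u / 2) ^+ 2 = 1 / 3 * r ^+ 2.
    by rewrite -g2 /u; field.
  rewrite uu sqrrD; move: ss hs hu hh; rewrite !expr2; lra.
(* As [g^2 = 1/3] and [p^2 = 2/3], the left side is at most [32/9 * r^4], which explains the 32. *)
have kd : 4 * (u * s) ^+ 2 <= d%:R * (del / 3 * r ^+ 2) ^+ 2.
  have -> : 4 * (u * s) ^+ 2 = 16 * g ^+ 2 * p ^+ 2 * (1 - del) ^+ 2 * (r ^+ 2) ^+ 2.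
    by rewrite /u /s; ring.
  have -> : d%:R * (del / 3 * r ^+ 2) ^+ 2 = (d%:R * del ^+ 2) / 9 * (r ^+ 2) ^+ 2 by field.
  rewrite ler_wpM2r ?sqr_ge0 // g2 p2.
  have : (1 - del) ^+ 2 <= 1 by rewrite expr_le1 //; lra.
  lra.
have k0 : 0 < del / 3 * r ^+ 2 by rewrite mulr_gt0 ?exprn_gt0 //; lra.
apply: le_trans (energy_ge r s u _ (ltW r0) s0 u0 k0 d0 bnd kd).
have -> : c^-1 * ((1 - del) * (1 - 2 * del) ^+ 2 / (1 + del) ^+ 3) =
  (2 * g * ((1 - del) / (1 + del))) * (p * ((1 - 2 * del) / (1 + del))) ^+ 2.
  rewrite energy_const_inv; have -> : 4 / 3 * g = 2 * g * p ^+ 2 by rewrite p2; field.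
  by field; rewrite gt_eqF //; lra.
rewrite -exprMM2.
rewrite ler_pM ?mulr_ge0 ?exprn_ge0 //.
by rewrite lerXn2r ?nnegrE ?mulr_ge0 ?exprn_ge0.
Qed.

End EnergyEstimate.

(** * Logarithmic estimates, uniform in the dimension and the radius *)

Section LogEstimates.
Context {R : realType}.

Local Notation c := (3 * Num.sqrt 3 / 4 : R).

(** Apply [ln (1 + z) <= z] to the inverse [1 + x / (1 - x)], where [x / (1 - x) <= 2 x]. *)
Lemma ln1B_ge (x : R) : 0 <= x <= 2^-1 -> - (2 * x) <= ln (1 - x).
Proof.
move=> /andP[x0 x1]; rewrite lerNl -lnV ?posrE; last lra.
have -> : (1 - x)^-1 = 1 + x / (1 - x) by field; rewrite gt_eqF //; lra.
have q0 : 0 <= x / (1 - x) by apply: divr_ge0; lra.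
apply: le_trans (le_ln1Dx _) _; first lra.
rewrite ler_pdivrMr; nra.
Qed.

Lemma ln2_le1 : ln 2 <= 1 :> R.
Proof. by have -> : 2 = 1 + 1 :> R by []; apply: le_ln1Dx; lra. Qed.

Lemma ln_c_bounds : 0 < ln c <= 1.
Proof.
have /andP[c1 c2] := @energy_const_bounds R.
rewrite ln_gt0 //=; have -> : c = 1 + (c - 1) by ring.
by apply: le_trans (le_ln1Dx _) _; lra.
Qed.

(** Since [c < 2], the numerator costs at most [86 th] and the denominator [6 th]; 100 is a round
    bound. *)
Lemma ln_rate_upper (th : R) : 0 < th <= 2^-1 ->
  ln ((c^-1 + 43 * th) / (1 - th) ^+ 3) <= - ln c + 100 * th.
Proof.
move=> /andP[t0 t1]; have /andP[] := @energy_const_bounds R; move: c => C c1 c2.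
have c0 : 0 < C by lra.
have ct1 : 0 < C * th by rewrite mulr_gt0.
have ct2 : C * th < 2 * th by rewrite ltr_pM2r.
have -> : (C^-1 + 43 * th) / (1 - th) ^+ 3 =
    C^-1 * (1 + 43 * (C * th)) * ((1 - th) ^+ 3)^-1.
  rewrite mulrDr mulr1 (mulrCA C^-1) mulKf ?gt_eqF //.
have ? : 0 < 1 + 43 * (C * th) by lra.
have ? : 0 < 1 - th by lra.
rewrite !lnM ?posrE ?mulr_gt0 ?invr_gt0 ?exprn_gt0 //.
rewrite !lnV ?posrE ?exprn_gt0 // lnXn // -[ln _ *+ 3]mulr_natl.
have := ln1B_ge th; rewrite t1 ltW // => /(_ isT).
have : ln (1 + 43 * (C * th)) <= 43 * (C * th) by apply: le_ln1Dx; lra.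
lra.
Qed.

(** The three factors cost at most [2 del], [8 del] and [3 del]. *)
Lemma ln_rate_lower (del : R) : 0 < del <= 4^-1 ->
  - ln c - 13 * del <=
  ln (c^-1 * ((1 - del) * (1 - 2 * del) ^+ 2 / (1 + del) ^+ 3)).
Proof.
move=> /andP[t0 t1]; have /andP[] := @energy_const_bounds R; move: c => C c1 c2.
have c0 : 0 < C by lra.
have [? ? ?] : [/\ 0 < 1 - del, 0 < 1 - 2 * del & 0 < 1 + del] by split; lra.
rewrite !lnM ?posrE ?mulr_gt0 ?invr_gt0 ?exprn_gt0 //.
rewrite !lnV ?posrE ?exprn_gt0 // !lnXn //.
rewrite -[ln _ *+ 3]mulr_natl.
have := ln1B_ge del; have := ln1B_ge (2 * del).
have -> : 0 <= 2 * del <= 2^-1 by apply/andP; split; lra.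
have -> : 0 <= del <= 2^-1 by apply/andP; split; lra.
move=> /(_ isT) ? /(_ isT) ?.
have : ln (1 + del) <= del by apply: le_ln1Dx; lra.
lra.
Qed.

Lemma lnXM (x y : R) d k : 0 < x -> 0 < y ->
  ln (x ^+ d * y ^+ k) = d%:R * ln x + k%:R * ln y.
Proof.
move=> x0 y0; rewrite lnM ?posrE ?exprn_gt0 //.
by rewrite (lnXn d x0) (lnXn k y0) !mulr_natl.
Qed.

Lemma energy_gt0 (d : nat) (r : R) : 0 <= r -> (0 < additive_energy (lball d r))%N.
Proof.
move=> r0; rewrite cardfs_gt0; apply/fset0Pn; exists (0, 0, (0, 0)).
have l0 : (0 : 'rV[int]_d) \in lball d r by exact: lball0.
by rewrite !inE /= !l0 /=.
Qed.

(** The thresholds depend on [eps] only. Half of the error pays for the perturbed rate; the other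
    half absorbs [ln m.+1] or [ln 2], constants once [eps] is fixed. *)
Lemma ln_energy (eps : R) : 0 < eps -> exists eta D : R, 0 < eta /\
  forall (d : nat) (r : R), (0 < d)%N -> D <= d%:R -> 0 < r ->
    rootd R d <= eta * r ->
    `|ln (additive_energy (lball d r))%:R -
      (3 * ln (lcount d r)%:R - d%:R * ln c)| <= eps * d%:R.
Proof.
move=> eps0.
pose th : R := Num.min 2^-1 (eps / 200).
have th0 : 0 < th by rewrite lt_min; apply/andP; split; lra.
have [th1 theps] : th <= 2^-1 /\ th <= eps / 200 by rewrite !ge_min !lexx orbT.
pose del : R := Num.min 4^-1 (eps / 26).
have e0 : 0 < del by rewrite lt_min; apply/andP; split; lra.
have [e1 eeps] : del <= 4^-1 /\ del <= eps / 26 by rewrite !ge_min !lexx orbT.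
pose m := Num.truncn th^-1.
have mth : m.+1%:R^-1 <= th.
  by rewrite -[leRHS]invrK lef_pV2 ?posrE ?invr_gt0 ?ltr0n // ltW // truncnS_gt.
(* The first entry of the maximum serves Chebyshev's inequality, the second gives
   [m.+2 <= eps / 2 * d]. *)
exists (Num.min th (del / 15)), (Num.max (32 / del ^+ 2) (2 * m.+2%:R / eps)).
split; first by rewrite lt_min th0 divr_gt0.
move=> d r d0; rewrite ge_max => /andP[dD1 dD2] r0 hr.
have [hr1 hr2] : rootd R d <= th * r /\ rootd R d <= del / 15 * r.
  by split; apply: (le_trans hr); rewrite ler_wpM2r ?(ltW r0) // ge_min lexx ?orbT.
have E0 : 0 < (additive_energy (lball d r))%:R :> R by rewrite ltr0n energy_gt0 // ltW.
have N0 : 0 < (lcount d r)%:R :> R by rewrite ltr0n lcount_gt0 // ltW.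
have dR : 0 < d%:R :> R by rewrite ltr0n.
have dm : m.+2%:R <= eps / 2 * d%:R.
  by move: dD2; rewrite ler_pdivrMr //; lra.
have /andP[c1 c2] := @energy_const_bounds R.
have ci : 0 < c^-1 by rewrite invr_gt0; lra.
rewrite ler_distl; apply/andP; split.
  have del2 : 32 <= d%:R * del ^+ 2 by move: dD1; rewrite ler_pdivrMr // exprn_gt0.
  have X0 : 0 < c^-1 * ((1 - del) * (1 - 2 * del) ^+ 2 / (1 + del) ^+ 3).
    by rewrite mulr_gt0 // divr_gt0 ?mulr_gt0 ?exprn_gt0 //; lra.
  have := energy_lower d r del r0 e0 e1 d0 hr2 del2.
  have := ln_rate_lower del; rewrite e0 e1 => /(_ isT).
  move: (c^-1 * _) X0 => X X0 XE.
  rewrite -ler_ln ?posrE ?mulr_gt0 ?exprn_gt0 // lnXM // lnM ?posrE // => le1.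
  have dX : d%:R * (- ln c - 13 * del) <= d%:R * ln X by rewrite ler_wpM2l.
  have ln2 : ln 2 <= 1 :> R by exact: ln2_le1.
  have dd : d%:R * del <= d%:R * (eps / 26) by rewrite ler_wpM2l.
  have m2 : 2 <= m.+2%:R :> R by rewrite ler_nat.
  move: le1; lra.
have X0 : 0 < (c^-1 + 43 * th) / (1 - th) ^+ 3.
  by rewrite divr_gt0 ?exprn_gt0 //; lra.
have := energy_upper d r th m r0 th0 th1 hr1 mth.
have := ln_rate_upper th; rewrite th0 th1 => /(_ isT).
move: ((c^-1 + _) / _) X0 => X X0 XE.
rewrite -ler_ln ?posrE ?mulr_gt0 ?exprn_gt0 ?ltr0Sn //.
rewrite lnM ?posrE ?mulr_gt0 ?exprn_gt0 ?ltr0Sn // lnXM // => le1.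
have dX : d%:R * ln X <= d%:R * (- ln c + 100 * th) by rewrite ler_wpM2l.
have lnm : ln m.+1%:R <= m.+2%:R :> R.
  by rewrite (le_trans (ltW (ln_sublinear _))) ?ltr0n // ler_nat.
have dd : d%:R * th <= d%:R * (eps / 200) by rewrite ler_wpM2l.
move: le1; lra.
Qed.

(** Take logarithms in [lcount_ge] and [lcount_le], with [ln h = ln d / 2]; the 7 comes from
    [128 = 2^7] and [ln 2 <= 1]. *)
Lemma ln_lcount (d : nat) (r : R) : (0 < d)%N -> rootd R d <= r ->
  `|ln (lcount d r)%:R - (d%:R * ln r - d%:R / 2 * ln d%:R)| <= 7 * d%:R.
Proof.
move=> d0 hr; have h0 : 0 < rootd R d by rewrite sqrtr_gt0 ltr0n.
have r0 : 0 < r := lt_le_trans h0 hr.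
have dR : 0 < d%:R :> R by rewrite ltr0n.
have N0 : 0 < (lcount d r)%:R :> R by rewrite ltr0n lcount_gt0 // ltW.
have lnh : ln (rootd R d) = ln d%:R / 2.
  have : rootd R d ^+ 2 = d%:R by rewrite sqr_sqrtr.
  by move=> <-; rewrite lnXn // -mulr_natl; field.
have ln2 : ln 2 <= 1 :> R by exact: ln2_le1.
have ln128 : ln 128 = 7 * ln 2 :> R.
  have -> : 128 = 2 ^+ 7 :> R by ring.
  by rewrite lnXn // mulr_natl.
have := lcount_le r d0 hr; have := lcount_ge r d0 hr.
have p128 : 0 < 128 :> R by [].
move: (128 : R) p128 ln128 => b b0 lnb lo hi.
have rh : 0 < r / rootd R d by rewrite divr_gt0.
have lnrh : ln (r / rootd R d) = ln r - ln d%:R / 2 by rewrite ln_div ?posrE // lnh.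
have {}lo : d%:R * (ln r - ln d%:R / 2 - ln 2) <= ln (lcount d r)%:R.
  rewrite -lnrh -ln_div ?posrE // mulr_natl -lnXn ?divr_gt0 //.
  rewrite ler_ln ?posrE ?exprn_gt0 ?divr_gt0 //.
  by rewrite -mulrA -invfM [_ * 2]mulrC.
have {}hi : ln (lcount d r)%:R <= d%:R * (ln b + (ln r - ln d%:R / 2)).
  rewrite -lnrh -lnM ?posrE // mulr_natl -lnXn; last exact: mulr_gt0.
  by rewrite ler_ln // posrE // exprn_gt0 // mulr_gt0.
move: hi lo; rewrite lnb => hi lo.
have dl : d%:R * ln 2 <= d%:R :> R by rewrite ler_piMr.
rewrite ler_distl; apply/andP; split; lra.
Qed.

End LogEstimates.

(** * The limit along a sequence of dimensions *)

Section Asymptotics.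
Context {R : realType}.

Local Notation c := (3 * Num.sqrt 3 / 4 : R).

Lemma ln_nat_near (A : R) : \forall n \near \oo, A <= ln n%:R.
Proof.
near=> n; rewrite -[A]expRK ler_ln ?posrE ?expR_gt0 //; first by near: n; exact: nbhs_infty_ger.
by rewrite ltr0n; near: n; exact: nbhs_infty_ge.
Unshelve. all: by end_near. Qed.

Lemma ball_radius_near : \forall n \near \oo,
  (n%:R / 4 : R) <= (ball_radius n)%:R <= (n%:R : R).
Proof.
near=> n; have n4 : (4 <= n)%N by near: n; exact: nbhs_infty_ge.
rewrite ler_pdivrMr // -natrM !ler_nat /ball_radius; lia.
Unshelve. all: by end_near. Qed.

Section Sequence.
Variable d : nat -> nat.
Hypothesis dy : d n @[n --> \oo] --> \oo.
Hypothesis lnd : (fun n => ln ((d n)%:R : R)) =o_\oo (fun n => ln (n%:R : R)).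

Let d_near (K : R) : \forall n \near \oo, K <= (d n)%:R.
Proof.
have /cvgnyPge /(_ (Num.truncn K).+1) := dy; apply: filterS => n.
by rewrite -(ler_nat R); apply: le_trans; rewrite ltW // truncnS_gt.
Qed.

Let d_gt0_near : \forall n \near \oo, (0 < d n)%N.
Proof. by have /cvgnyPge /(_ 1%N) := dy. Qed.

Let lnd_near (eps : R) : 0 < eps ->
  \forall n \near \oo, ln (d n)%:R <= eps * ln n%:R.
Proof.
move=> e0; have /eqoP /(_ _ e0) := lnd; apply: filter_app.
near=> n => /(le_trans (ler_norm _)); rewrite ger0_norm //.
by near: n; exact: ln_nat_near.
Unshelve. all: by end_near. Qed.

(** Eventually [d n <= n], so [sqrt d <= sqrt n], and this is at most [eta * n / 4] once
    [sqrt n >= 4 / eta]. *)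
Let rootd_near (eta : R) : 0 < eta ->
  \forall n \near \oo, rootd R (d n) <= eta * (ball_radius n)%:R.
Proof.
move=> e0; near=> n.
have n0 : 0 < n%:R :> R by rewrite ltr0n; near: n; exact: nbhs_infty_ge.
have d0 : 0 < (d n)%:R :> R by rewrite ltr0n; near: n; exact: d_gt0_near.
have dn : (d n)%:R <= n%:R :> R.
  by rewrite -ler_ln ?posrE // -[leRHS]mul1r; near: n; exact: lnd_near.
have /andP[rn _] : (n%:R / 4 : R) <= (ball_radius n)%:R <= (n%:R : R).
  by near: n; exact: ball_radius_near.
have sn : 4 / eta <= Num.sqrt n%:R :> R.
  rewrite -ler_sqr ?nnegrE ?sqrtr_ge0 ?divr_ge0 ?(ltW e0) // sqr_sqrtr ?(ltW n0) //.
  by near: n; exact: nbhs_infty_ger.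
apply: (@le_trans _ _ (Num.sqrt n%:R)); first by rewrite ler_sqrt // ltW.
apply: (@le_trans _ _ (eta * (n%:R / 4))); last by rewrite ler_wpM2l // ltW.
have s0 : 0 <= Num.sqrt n%:R :> R by exact: sqrtr_ge0.
have := sqr_sqrtr (ltW n0); move: (Num.sqrt n%:R) sn s0 => s sn s0 <-.
have : s * (4 / eta) <= s * s by rewrite ler_wpM2l.
by rewrite mulrA ler_pdivrMr // expr2; lra.
Unshelve. all: by end_near. Qed.

Local Notation N n := ((ball_card R (d n) n)%:R : R).
Local Notation E n := ((ball_energy R (d n) n)%:R : R).

(** Replacing the logarithm of the radius by [ln n] costs at most [ln 4 <= 2] per dimension, on top
    of the 7 of [ln_lcount]. *)
Let ln_card_near : \forall n \near \oo,
  `|ln (N n) - ((d n)%:R * ln n%:R - (d n)%:R / 2 * ln (d n)%:R)| <= 10 * (d n)%:R.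
Proof.
near=> n.
have n0 : 0 < n%:R :> R by rewrite ltr0n; near: n; exact: nbhs_infty_ge.
have /andP[r1 r2] : (n%:R / 4 : R) <= (ball_radius n)%:R <= (n%:R : R).
  by near: n; exact: ball_radius_near.
have r0 : 0 < (ball_radius n)%:R :> R by apply: lt_le_trans r1; rewrite divr_gt0.
have d0 : (0 < d n)%N by near: n; exact: d_gt0_near.
have hr : rootd R (d n) <= (ball_radius n)%:R.
  by rewrite -[leRHS]mul1r; near: n; exact: rootd_near.
rewrite ball_cardE; have := ln_lcount (d n) _ d0 hr.
have ln4 : ln 4 <= 2 :> R.
  have -> : 4 = 2 ^+ 2 :> R by ring.
  by rewrite lnXn // -[_ *+ 2]mulr_natl; have := @ln2_le1 R; lra.
have l1 : ln n%:R - ln 4 <= ln (ball_radius n)%:R :> R.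
  by rewrite -ln_div ?posrE // ler_ln ?posrE ?divr_gt0.
have l2 : ln (ball_radius n)%:R <= ln n%:R :> R by rewrite ler_ln ?posrE.
have dl1 : (d n)%:R * (ln n%:R - 2) <= (d n)%:R * ln (ball_radius n)%:R :> R.
  by rewrite ler_wpM2l //; lra.
have dl2 : (d n)%:R * ln (ball_radius n)%:R <= (d n)%:R * ln n%:R :> R.
  by rewrite ler_wpM2l.
have d1 : 0 <= (d n)%:R :> R by [].
rewrite !ler_distl => /andP[lo hi]; apply/andP; split; lra.
Unshelve. all: by end_near. Qed.

Let ln_energy_near (eps : R) : 0 < eps -> \forall n \near \oo,
  `|ln (E n) - (3 * ln (N n) - (d n)%:R * ln c)| <= eps * (d n)%:R.
Proof.
move=> e0; have [eta [D [eta0 H]]] := ln_energy eps e0.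
near=> n; rewrite ball_cardE ball_energyE; apply: H.
- by near: n; exact: d_gt0_near.
- by near: n; exact: d_near.
- have /andP[r1 _] : (n%:R / 4 : R) <= (ball_radius n)%:R <= (n%:R : R).
    by near: n; exact: ball_radius_near.
  by apply: lt_le_trans r1; rewrite divr_gt0 // ltr0n; near: n; exact: nbhs_infty_ge.
- by near: n; exact: rootd_near.
Unshelve. all: by end_near. Qed.

(** The errors [d / 2 * ln d] and [10 d] each take at most half of the bound: the first by
    [ln d = o(ln n)], the second because [ln n] tends to infinity. *)
Let ln_card_equiv (eps : R) : 0 < eps -> \forall n \near \oo,
  `|(d n)%:R * ln n%:R - ln (N n)| <= eps * ((d n)%:R * ln n%:R).
Proof.
move=> e0; near=> n.
have : `|ln (N n) - ((d n)%:R * ln n%:R - (d n)%:R / 2 * ln (d n)%:R)| <= 10 * (d n)%:R.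
  by near: n; exact: ln_card_near.
have d0 : 0 <= (d n)%:R :> R by [].
have d1 : 1 <= (d n)%:R :> R by near: n; exact: d_near.
have ld0 : 0 <= ln (d n)%:R :> R by exact: ln_ge0.
have ld : ln (d n)%:R <= eps * ln n%:R by near: n; exact: lnd_near.
have l10 : 10 <= eps / 2 * ln n%:R.
  rewrite mulrC -ler_pdivrMr ?divr_gt0 //; near: n; exact: ln_nat_near.
have dl0 : 0 <= (d n)%:R * ln (d n)%:R :> R by rewrite mulr_ge0.
have dl1 : (d n)%:R * ln (d n)%:R <= (d n)%:R * (eps * ln n%:R) by rewrite ler_wpM2l.
have dl2 : (d n)%:R * 10 <= (d n)%:R * (eps / 2 * ln n%:R) by rewrite ler_wpM2l.
rewrite !ler_distl => /andP[lo hi]; apply/andP; split; lra.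
Unshelve. all: by end_near. Qed.

(** The solution of [ln E / ln N = 3 - (ln c + e) / ln n]. *)
Let e n : R := (3 - ln (E n) / ln (N n)) * ln n%:R - ln c.

Let e_small : e =o_\oo (fun=> 1 : R).
Proof.
apply/eqoP => eps e0.
pose eps1 := Num.min 2^-1 (eps / 4).
have e10 : 0 < eps1 by rewrite lt_min; apply/andP; split; lra.
have [e11 e12] : eps1 <= 2^-1 /\ eps1 <= eps / 4 by rewrite !ge_min !lexx orbT.
near=> n; rewrite normr1 mulr1.
have H1 : `|(d n)%:R * ln n%:R - ln (N n)| <= eps1 * ((d n)%:R * ln n%:R).
  by near: n; exact: ln_card_equiv.
have H2 : `|ln (E n) - (3 * ln (N n) - (d n)%:R * ln c)| <= eps1 * (d n)%:R.
  by near: n; exact: ln_energy_near.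
have y1 : 1 <= ln n%:R :> R by near: n; exact: ln_nat_near.
have d1 : 1 <= (d n)%:R :> R by near: n; exact: d_near.
have /andP[L0 L1] := @ln_c_bounds R.
rewrite /e; move: (ln (E n)) (ln (N n)) (ln n%:R) (d n)%:R (ln c) H1 H2 y1 d1 L0 L1.
move=> P A y D L H1 H2 y1 d1 L0 L1.
have Dy : 0 < D * y by rewrite mulr_gt0 //; lra.
have A0 : D * y / 2 <= A.
  have : eps1 * (D * y) <= 2^-1 * (D * y) by rewrite ler_wpM2r // ltW.
  by move: H1; rewrite ler_distlC => /andP[]; lra.
have Ap : 0 < A by lra.
(* The numerator is the energy error times [ln n] plus [ln c] times the cardinality error, both
   [o(d ln n)], while [A] is at least half of [d ln n]. *)
have -> : (3 - P / A) * y - L = ((3 * A - D * L - P) * y + L * (D * y - A)) / A.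
  by field; rewrite gt_eqF.
rewrite normrM normfV (gtr0_norm Ap) ler_pdivrMr //.
apply: (le_trans (ler_normD _ _)); rewrite !normrM (gtr0_norm L0).
have K1 : `|3 * A - D * L - P| * `|y| <= eps1 * D * y.
  by rewrite distrC (ger0_norm (_ : 0 <= y)) ?ler_wpM2r //; lra.
have K2 : L * `|D * y - A| <= 1 * (eps1 * (D * y)) by rewrite ler_pM // ltW.
have K3 : eps1 * (D * y) <= eps / 4 * (D * y) by rewrite ler_wpM2r // ltW.
have K4 : eps * (D * y / 2) <= eps * A by rewrite ler_wpM2l // ltW.
lra.
Unshelve. all: by end_near. Qed.

Let energy_powR : \forall n \near \oo,
  E n = N n `^ (3 - (ln c + e n) / ln n%:R).
Proof.
near=> n.
have y1 : 1 <= ln n%:R :> R by near: n; exact: ln_nat_near.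
have d1 : 1 <= (d n)%:R :> R by near: n; exact: d_near.
have H1 : `|(d n)%:R * ln n%:R - ln (N n)| <= 2^-1 * ((d n)%:R * ln n%:R).
  by near: n; apply: ln_card_equiv; lra.
have Dy : 0 < (d n)%:R * ln n%:R :> R by rewrite mulr_gt0 //; lra.
have A0 : 0 < ln (N n) by move: H1; rewrite ler_distlC => /andP[]; lra.
have N0 : 0 < N n by rewrite ball_cardE ltr0n lcount_gt0.
have E0 : 0 < E n by rewrite ball_energyE ltr0n energy_gt0.
have -> : 3 - (ln c + e n) / ln n%:R = ln (E n) / ln (N n).
  by rewrite /e; field; rewrite !gt_eqF //; lra.
by rewrite /powR gt_eqF // divfK ?gt_eqF // lnK.
Unshelve. all: by end_near. Qed.

Lemma energy_asymptotics_of_little_dim : energy_asymptotics R d.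
Proof.
have /andP[L0 L1] := @ln_c_bounds R.
split.
- by move=> n; exact: shifted_lattice_ball_box.
- apply/eqaddOP; near=> k; near=> n.
  rewrite (ger0_norm (ler0n R (d n))) (@le_trans _ _ (10 * (d n)%:R)) //.
    by near: n; exact: ln_card_near.
  by rewrite ler_wpM2r //; near: k; exact: nbhs_pinfty_ge.
- apply/eqaddoP => eps e0; near=> n; rewrite (ger0_norm (ler0n R (d n))).
  by near: n; exact: ln_energy_near.
- by exists e.
- exists (fun n => e n / ln c).
    apply/eqoP => eps e0; have eL : 0 < eps * ln c by rewrite mulr_gt0.
    have /eqoP /(_ _ eL) := e_small; apply: filterS => n.
    rewrite normr1 !mulr1 normrM normfV (gtr0_norm L0).
    by rewrite ler_pdivrMr.
  have := energy_powR; apply: filterS => n ->.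
  congr (_ `^ (3 - _)); rewrite /log_base [RHS]mulrA [X in _ = X / _]mulrDl mul1r divfK //.
  by rewrite gt_eqF.
Unshelve. all: by end_near. Qed.

End Sequence.
End Asymptotics.

(** * The dimension [floor (sqrt (log n))] *)

Lemma ln_succ_ge {R : realType} (m : nat) : (0 < m)%N ->
  ln m%:R + m.+1%:R^-1 <= ln m.+1%:R :> R.
Proof.
move=> m0; have m0R : 0 < m%:R :> R by rewrite ltr0n.
have m1R : 0 < m.+1%:R :> R by rewrite ltr0n.
have : ln (1 + - m.+1%:R^-1) <= - m.+1%:R^-1 :> R.
  by apply: le_ln1Dx; rewrite ltrN2 invf_lt1 // ltr1n.
have -> : 1 + - m.+1%:R^-1 = m%:R / m.+1%:R :> R.
  by rewrite -[m%:R](addrK 1) natr1 mulrBl divff ?gt_eqF // mul1r.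
by rewrite ln_div ?posrE // lerBlDr addrC lerBrDr.
Qed.

(* [ln 3 = ln 12 - ln 4 >= 1/5 + ... + 1/12 > 1]. *)
Lemma ln3_ge1 {R : realType} : 1 <= ln 3 :> R.
Proof.
have : ln 12%:R = ln 3 + ln 4%:R :> R.
  have -> : 12%:R = 3 * 4%:R :> R by rewrite -natrM.
  by rewrite lnM ?posrE.
have := @ln_succ_ge R 4 isT; have := @ln_succ_ge R 5 isT.
have := @ln_succ_ge R 6 isT; have := @ln_succ_ge R 7 isT.
have := @ln_succ_ge R 8 isT; have := @ln_succ_ge R 9 isT.
have := @ln_succ_ge R 10 isT; have := @ln_succ_ge R 11 isT.
lra.
Qed.

Theorem corollary1p2 (R : realType) :
  (forall d : nat -> nat,
     (forall n, (2 <= n)%N -> (0 < d n)%N) ->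
     d n @[n --> \oo] --> \oo ->
     (fun n => ln ((d n)%:R : R)) =o_\oo (fun n => ln (n%:R : R)) ->
     energy_asymptotics R d) /\
  (let d n := Num.truncn (ln (n%:R : R) `^ 2^-1) in
   [/\ forall n, (3 <= n)%N -> (0 < d n)%N,
       d n @[n --> \oo] --> \oo,
       (fun n => ln ((d n)%:R : R)) =o_\oo (fun n => ln (n%:R : R)) &
       energy_asymptotics R d]).
Proof.
split=> [d _|]; first exact: energy_asymptotics_of_little_dim.
move=> d.
(* [ln 3 >= 1] makes the integer part positive from [n = 3] on; at [n = 2] it is 0. *)
have d_gt0 n : (3 <= n)%N -> (0 < d n)%N.
  move=> n3; have ln1 : 1 <= ln n%:R :> R.
    apply: le_trans ln3_ge1 _; rewrite ler_ln ?posrE ?ler_nat //.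
    by rewrite ltr0n (leq_trans _ n3).
  by rewrite truncn_gt0 powR12_sqrt ?(le_trans ler01 ln1) // -[leLHS]sqrtr1 ler_wsqrtr.
have dy : d n @[n --> \oo] --> \oo.
  apply/cvgnyPge => A; near=> n.
  have lnA : A%:R ^+ 2 <= ln n%:R :> R by near: n; exact: ln_nat_near.
  have ln0 : 0 <= ln n%:R :> R by rewrite (le_trans (sqr_ge0 _) lnA).
  rewrite truncn_ge_nat ?powR_ge0 // powR12_sqrt //.
  by rewrite -[leLHS]ger0_norm // -sqrtr_sqr ler_wsqrtr.
(* [ln d <= d <= sqrt (ln n)], which is at most [eps * ln n] once [sqrt (ln n) >= 1 / eps]. *)
have lnd : (fun n => ln ((d n)%:R : R)) =o_\oo (fun n => ln (n%:R : R)).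
  apply/eqoP => eps e0; near=> n.
  have d0 : (0 < d n)%N by apply: d_gt0; near: n; exact: nbhs_infty_ge.
  have lne : eps^-1 ^+ 2 <= ln n%:R :> R by near: n; exact: ln_nat_near.
  have ln0 : 0 <= ln n%:R :> R by rewrite (le_trans (sqr_ge0 _) lne).
  have lnd0 : 0 <= ln (d n)%:R :> R by rewrite ln_ge0 // ler1n.
  rewrite !ger0_norm // (@le_trans _ _ (d n)%:R) //.
    by rewrite ltW // ln_sublinear // ltr0n.
  apply: (@le_trans _ _ (Num.sqrt (ln n%:R))).
    by rewrite -powR12_sqrt // truncn_le // powR_ge0.
  have s0 : 0 <= Num.sqrt (ln n%:R) :> R := sqrtr_ge0 _.
  have es : eps^-1 <= Num.sqrt (ln n%:R).
    by rewrite -[leLHS]ger0_norm ?invr_ge0 ?(ltW e0) // -sqrtr_sqr ler_wsqrtr.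
  rewrite -{2}(sqr_sqrtr ln0) expr2 mulrA ler_peMl // -ler_pdivrMl //.
  by rewrite mulr1.
split=> //; exact: energy_asymptotics_of_little_dim.
Unshelve. all: by end_near. Qed.
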